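(* Let $0<\eta<T$, $0<\alpha<\frac{2T}{\eta^2}$ and $0\le\beta<\frac{2T-\alpha\eta^2}{\alpha\eta^2-2\eta+2T}$ be real constants. Let $f\in C([0,\infty),[0,\infty))$, and let $a\in C([0,T],[0,\infty))$ be such that there exists $t_0\in[\eta,T]$ with $a(t_0)>0$. Let $\gamma$ and $\Lambda_2$ be the constants defined in the context. Assume that (i) $\lim_{u\to0^+}\frac{f(u)}{u}=0$ and $\lim_{u\to\infty}\frac{f(u)}{u}=0$; (ii) there exist constants $\rho_2>0$ and $M_2\in[\Lambda_2,\infty)$ such that $f(u)\ge M_2\rho_2$ for all $u\in[\gamma\rho_2,\rho_2]$. Then the boundary value problem $$u''(t)+a(t)f(u(t))=0,\quad 0<t<T,\qquad u(0)=\beta u(\eta),\quad u(T)=\alpha\int_0^\eta u(s)\,ds,$$ has at least two positive solutions $u_1$ and $u_2$ such that $0<\|u_1\|<\rho_2<\|u_2\|$.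
   Context: $\|u\|=\max_{t\in[0,T]}|u(t)|$ is the sup norm on $C([0,T],\mathbb{R})$. A positive solution of the boundary value problem is a function $u\in C([0,T])$, twice continuously differentiable on $(0,T)$, satisfying the differential equation on $(0,T)$ and both boundary conditions, with $u(t)\ge0$ on $[0,T]$ and $u(t)>0$ for $t\in(0,T)$. Define $$\gamma=\min\left\{\frac{\eta}{T},\ \frac{\alpha(\beta+1)\eta^2}{2T},\ \frac{\alpha(\beta+1)\eta(T-\eta)}{2T-\alpha(\beta+1)\eta^2}\right\}\in(0,1),$$ $$\Lambda_2=\frac{(2T-\alpha\eta^2)-\beta(\alpha\eta^2-2\eta+2T)}{2\gamma\eta\int_\eta^T(T-s)a(s)\,ds}.$$ *)

(* Defs.v *)
From mathcomp Require Import all_boot all_order all_algebra.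
From mathcomp Require Import all_classical all_reals all_analysis.

Set Implicit Arguments.
Unset Strict Implicit.
Unset Printing Implicit Defensive.

Import Order.TTheory GRing.Theory Num.Theory.
Import numFieldNormedType.Exports.

Local Open Scope classical_set_scope.
Local Open Scope ring_scope.

(* Functions on [0, T], resp. [0, +oo[, are represented by total functions
   R -> R that are only ever constrained and evaluated on that set. *)

Definition sup_norm (R : realType) (T : R) (u : R -> R) : R :=
  sup [set `|u t| | t in `[0, T]].

Definition C2_on_open (R : realType) (T : R) (u : R -> R) : Prop :=
  forall t : R, t \in `]0, T[ ->
    [/\ derivable u t 1, derivable u^`()%classic t 1 & {for t, continuous u^`(2)%classic}].

Definition bvp_solution (R : realType) (T eta alpha beta : R)
    (a f u : R -> R) : Prop :=
  [/\ {within `[0, T], continuous u},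
      C2_on_open T u,
      forall t : R, t \in `]0, T[ -> u^`(2)%classic t + a t * f (u t) = 0,
      u 0 = beta * u eta
    & u T = alpha * \int[lebesgue_measure]_(s in `[0, eta]) u s].

Definition positive_bvp_solution (R : realType) (T eta alpha beta : R)
    (a f u : R -> R) : Prop :=
  [/\ bvp_solution T eta alpha beta a f u,
      forall t : R, t \in `[0, T] -> 0 <= u t
    & forall t : R, t \in `]0, T[ -> 0 < u t].

Definition bvp_gamma (R : realType) (T eta alpha beta : R) : R :=
  Num.min (eta / T)
    (Num.min (alpha * (beta + 1) * eta ^+ 2 / (2 * T))
             (alpha * (beta + 1) * eta * (T - eta) /
                (2 * T - alpha * (beta + 1) * eta ^+ 2))).

Definition bvp_Lambda2 (R : realType) (T eta alpha beta : R)
    (a : R -> R) : R :=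
  ((2 * T - alpha * eta ^+ 2)
     - beta * (alpha * eta ^+ 2 - 2 * eta + 2 * T)) /
  (2 * bvp_gamma T eta alpha beta * eta *
     \int[lebesgue_measure]_(s in `[eta, T]) ((T - s) * a s)).

(* Main.v *)
Require Import Defs.
From mathcomp Require Import all_boot all_order all_algebra.
From mathcomp Require Import zify ring lra.

(** The problem is equivalent to u(t) = \int_0^T k(t,s) a(s) f(u(s)) ds for a
    nonnegative kernel k, and every such u is concave with
    u >= gamma ||u|| on [eta, T].  Replace f(u(s)) by
    f(c(n) max(u(s), l(s))) / c(n), where n = ||u|| and
    l(s) = gamma rho2 min(1, s / eta), with c continuous, positive and equal
    to 1 for n <= rho2.  The new equation has a solution as soon as it is
    sublinear in n.  Its norm n exceeds rho2: if n <= rho2, then (ii) applies on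
    [eta, T] and forces u(eta) >= rho2 / gamma > rho2.  By concavity u >= l, so
    the truncation is inactive and c(n) u solves the original problem.  The
    choice c = 1 is sublinear by the limit at infinity and gives u2; the choice
    c(n) = (rho2 / n)^2 for n >= rho2 is sublinear by the limit at 0 and gives
    u1, of norm rho2^2 / n < rho2.

    Solutions of the sublinear equation are limits along an ultrafilter of
    fixed points of its Riemann-sum discretizations.  Those come from Brouwer's
    theorem, proved through Scarf's combinatorial lemma: a door (a dominant set
    with one element less than a room) extends to a room in exactly two ways,
    except for the outer door, which extends in one way. *)

Set Implicit Arguments.
Unset Strict Implicit.
Unset Printing Implicit Defensive.

Import Order.TTheory GRing.Theory Num.Theory.

(** The limit at 0 forces f(0) = 0, so the zero function solves the problem and a bare fixed point
    theorem may return nothing else. Truncating from below by l removes it, together with every norm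
    up to rho2, but this also removes the small solution that is wanted. The way out is that the
    differential operator and the boundary conditions are linear and homogeneous: a factor depending
    only on the norm of u is a constant for each given u and can be moved in and out of the
    nonlinearity. Inverting the norm turns the behaviour of f at 0 into behaviour at infinity, so
    one existence argument yields both solutions and no degree or fixed point index has to be
    computed.

    The size of Lambda_2 comes from the bound k(eta, s) >= 2 eta (T - s) / D for s in [eta, T],
    where D is the numerator of Lambda_2. If f >= M2 rho2 holds along the argument on [eta, T],
    integrating this bound gives u(eta) >= rho2 / gamma precisely when M2 >= Lambda_2 is
    available. *)

Section Scarf.

(** * Scarf's lemma for finitely many linear orders *)

Variables (I Y : finType) (r : I -> Y -> nat).
Hypothesis r_inj : forall i, injective (r i).

(** For nonempty A: no point lies strictly above the [r i]-minimum of A for all i at once. Rooms are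
    the dominant sets with as many elements as I. *)
Definition dominant (A : {set Y}) :=
  [forall z, exists i, forall t in A, r i z <= r i t].

Lemma dominantP (A : {set Y}) :
  reflect (forall z, exists i, forall t, t \in A -> r i z <= r i t)
          (dominant A).
Proof.
apply: (iffP forallP) => domA z.
  by have /existsP[i /forall_inP] := domA z; exists i.
by have [i hi] := domA z; apply/existsP; exists i; apply/forall_inP.
Qed.

Lemma dominantS (A B : {set Y}) : A \subset B -> dominant B -> dominant A.
Proof.
move=> /subsetP AB /dominantP domB; apply/dominantP => z.
by have [i hi] := domB z; exists i => t /AB /hi.
Qed.

Section Door.
Variables (A : {set Y}) (m : I -> Y).
Hypothesis domA : dominant A.
Hypothesis cardA : #|A|.+1 = #|I|.
Hypothesis m_in : forall i, m i \in A.
Hypothesis m_min : forall i t, t \in A -> r i (m i) <= r i t.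

Lemma door_minE i t : t \in A -> (forall t', t' \in A -> r i t <= r i t') ->
  t = m i.
Proof.
by move=> tA ht; apply: (r_inj (i := i)); apply/eqP; rewrite eqn_leq ht //= m_min.
Qed.

(** Dominance applied to a point of A itself makes that point minimal in some order. *)
Lemma door_imset : m @: setT = A.
Proof.
apply/eqP; rewrite eqEsubset; apply/andP; split; apply/subsetP => t.
  by case/imsetP => i _ ->.
move=> tA; have /dominantP/(_ t)[i hi] := domA.
by rewrite (door_minE tA hi) imset_f.
Qed.

(** [m] maps I onto A, which has one element less, so exactly one pair of indices collides.
    Surjectivity survives the removal of at most one index, and that index belongs to the pair. *)
Lemma door_collision : exists i1 i2, [/\ i1 != i2, m i1 = m i2 &
  forall J : {set I}, A \subset m @: (~: J) -> #|J| <= 1 /\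
     (forall k, k \in J -> k \in [set i1; i2])].
Proof.
have [i1 [i2 [ne eqm]]] : exists i1 i2, i1 != i2 /\ m i1 = m i2.
  have /injectivePn[i1 [i2 ne eqm]] : ~~ injectiveb m.
    apply/negP => /injectiveP m_inj.
    have := card_imset setT m_inj; rewrite door_imset cardsT -cardA.
    by move/eqP; rewrite eqn_leq ltnn andbF.
  by exists i2, i1; rewrite eq_sym.
exists i1, i2; split=> // J AJ.
have cJ : #|J| <= 1.
  have := leq_trans (subset_leq_card AJ) (leq_imset_card m _).
  by have := cardsC J; rewrite -cardA; lia.
split=> // k kJ; rewrite !inE; apply: contraT; rewrite negb_or => /andP[k1 k2].
have imE : m @: (~: J) = A.
  apply/eqP; rewrite eqEsubset AJ andbT.
  by apply/subsetP => t /imsetP[i _ ->].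
have cJ1 : #|J| = 1 by apply/eqP; rewrite eqn_leq cJ card_gt0; apply/set0Pn; exists k.
have /imset_injP injm : #|m @: (~: J)| == #|~: J|.
  by rewrite imE; have := cardsC J; rewrite -cardA; lia.
have inJ j : j != k -> j \in ~: J.
  rewrite inE; apply: contra => jJ; have /cards1P[x Jx] := introT eqP cJ1.
  by move: jJ kJ; rewrite Jx !inE => /eqP -> /eqP ->.
by move/eqP: ne; case; apply: injm => //; apply: inJ; rewrite eq_sym.
Qed.

Definition above_but k := [set y | [forall (j | j != k), r j (m j) < r j y]].

Lemma above_butP k y :
  reflect (forall j, j != k -> r j (m j) < r j y) (y \in above_but k).
Proof. by rewrite inE; exact: (iffP forall_inP). Qed.

(** Every point of A stays a minimum of the enlarged set for some index, so the indices where y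
    falls below [m] can all be removed while [m] still covers A. Hence there is at most one;
    dominance at y provides one. *)
Lemma below_unique y : y \notin A -> dominant (y |: A) ->
  exists2 k, y \in above_but k & r k y < r k (m k).
Proof.
move=> yA domW.
pose J := [set j | r j y < r j (m j)].
have AJ : A \subset m @: (~: J).
  apply/subsetP => t tA; have /dominantP/(_ t)[i hi] := domW.
  have -> : t = m i by apply: door_minE => // t' t'A; apply: hi; rewrite !inE t'A orbT.
  apply: imset_f; rewrite !inE -leqNgt.
  by rewrite (leq_trans (m_min i tA)) // hi // !inE eqxx.
have [i1 [i2 [_ _ /(_ J AJ)[cJ _]]]] := door_collision.
have [k hk] : exists k, r k y < r k (m k).
  have /dominantP/(_ y)[k hk] := domW; exists k.
  rewrite ltn_neqAle hk ?inE ?m_in ?orbT // andbT.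
  by apply: contra yA => /eqP /r_inj ->.
exists k => //; apply/above_butP => j jk; rewrite ltn_neqAle; apply/andP; split.
  by apply: contra yA => /eqP /r_inj <-.
rewrite leqNgt; apply: contra jk => jJ.
have /card_le1_eqP h1 := cJ.
by apply/eqP; apply: h1; rewrite inE.
Qed.

Lemma above_but_notin i1 i2 k y : i1 != i2 -> m i1 = m i2 ->
  k \in [set i1; i2] -> y \in above_but k -> y \notin A.
Proof.
have main j1 j2 : j1 != j2 -> m j1 = m j2 -> y \in above_but j1 -> y \notin A.
  move=> ne eqm /above_butP ya; apply/negP => yA.
  have := yA; rewrite -door_imset => /imsetP[i _ yE].
  have [ii|ne1] := eqVneq i j1; last by have := ya _ ne1; rewrite yE ltnn.
  by have := ya j2; rewrite eq_sym ne yE ii eqm ltnn => /(_ isT).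
by move=> ne eqm; rewrite in_set2 => /orP[]/eqP ->; [exact: (main _ _ ne eqm)|apply: (main i2 i1); rewrite 1?eq_sym].
Qed.

(** The extension is the [r k]-largest element of [above_but k]: with any smaller choice, that
    largest element would lie strictly above all minima of the enlarged set. *)
Lemma card_extension i1 i2 k : i1 != i2 -> m i1 = m i2 -> k \in [set i1; i2] ->
  #|[set y in above_but k | dominant (y |: A)]| = (above_but k != set0).
Proof.
move=> ne eqm ki.
have [->|/set0Pn[y0 y0k]] := eqVneq (above_but k) set0.
  by apply/eqP; rewrite cards_eq0; apply/eqP/setP => y; rewrite !inE.
apply/eqP/cards1P.
have [y /= yk ymax] := arg_maxnP (r k) y0k.
have yA := above_but_notin ne eqm ki yk.
have ylt : r k y < r k (m k).
  have /dominantP/(_ y)[i hi] := domA.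
  have [ii|nei] := eqVneq i k; last first.
    have /above_butP/(_ _ nei) := yk; by rewrite ltnNge hi.
  rewrite -ii ltn_neqAle hi // andbT.
  by apply: contra yA => /eqP /r_inj ->.
have domy : dominant (y |: A).
  apply/dominantP => z; have [zk|/above_butP zk] := boolP (z \in above_but k).
    exists k => t /setU1P[->|tA]; first exact: ymax.
    exact: leq_trans (ymax z zk) (leq_trans (ltnW ylt) (m_min k tA)).
  have /forall_inPn[j jk hj] : ~~ [forall (j | j != k), r j (m j) < r j z].
    by apply: contra_notN zk => /forall_inP.
  rewrite -leqNgt in hj.
  exists j => t /setU1P[->|tA]; last exact: leq_trans hj (m_min j tA).
  by apply: leq_trans hj _; apply: ltnW; move/above_butP: yk; apply.
exists y; apply/setP => z; rewrite in_set1 in_set.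
apply/andP/eqP => [[zk domz]|->]; last by [].
apply: (r_inj (i := k)); apply/eqP; rewrite eqn_leq ymax //= leqNgt.
apply/negP => zy.
have /dominantP/(_ y)[i hi] := domz.
have [ii|nei] := eqVneq i k.
  by have := hi z; rewrite !inE eqxx ii leqNgt zy => /(_ isT).
have := hi (m i); rewrite !inE m_in orbT leqNgt => /(_ isT) /negP; apply.
by move/above_butP: yk; apply.
Qed.

Lemma in_extension k y :
  (y \in [set y in above_but k | dominant (y |: A)]) =
  (y \in above_but k) && dominant (y |: A).
Proof. by rewrite in_set. Qed.

Lemma card_extensions i1 i2 : i1 != i2 -> m i1 = m i2 ->
  #|[set y | (y \notin A) && dominant (y |: A)]| =
  (above_but i1 != set0) + (above_but i2 != set0).
Proof.
move=> ne eqm.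
have i1in : i1 \in [set i1; i2] by rewrite !inE eqxx.
have i2in : i2 \in [set i1; i2] by rewrite !inE eqxx orbT.
rewrite -(card_extension ne eqm i1in) -(card_extension ne eqm i2in).
rewrite -cardsUI [X in _ + X](_ : _ = 0); last first.
  apply/eqP; rewrite cards_eq0 -subset0; apply/subsetP => y.
  rewrite in_setI !in_extension => /andP[/andP[/above_butP y1 _] /andP[/above_butP y2 _]].
  have /dominantP/(_ y)[i hi] := domA; have := hi _ (m_in i); rewrite leqNgt.
  have [ii|nei] := eqVneq i i1; last by rewrite y1.
  by rewrite y2 // ii.
rewrite addn0; congr #|pred_of_set _|; apply/setP => y.
rewrite in_set in_setU !in_extension; apply/andP/orP => [[yA domy]|].
  have [k yk ylt] := below_unique yA domy.
  pose J := [set j | r j y < r j (m j)].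
  have kin : k \in [set i1; i2].
    rewrite !inE; apply: contraT; rewrite negb_or => /andP[k1 k2].
    have [j1 [j2 [_ _ hJ]]] := door_collision.
    (* If k were outside the colliding pair, both k and [i1] could be removed: [m k] is also the
       minimum for another index, because y took over order k, and [m i1] equals [m i2]. *)
    have AJ : A \subset m @: (~: [set k; i1]).
      rewrite -door_imset; apply/subsetP => t /imsetP[i _ ->].
      have [ik|nik] := eqVneq i k.
        have /dominantP/(_ (m k))[i' hi'] := domy.
        have i'k : i' != k.
          apply: contraTneq ylt => ik'; rewrite -leqNgt; move: (hi' y).
          by rewrite ik'; apply; rewrite !inE eqxx.
        have mE : m k = m i'.
          by apply: door_minE => // t' t'A; apply: hi'; rewrite !inE t'A orbT.
        rewrite ik mE; have [i'1|ni'1] := eqVneq i' i1; last first.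
          by apply: imset_f; rewrite !inE negb_or i'k.
        by rewrite i'1 eqm; apply: imset_f; rewrite !inE negb_or eq_sym k2 eq_sym.
      have [ii1|nii1] := eqVneq i i1.
        by rewrite ii1 eqm; apply: imset_f; rewrite !inE negb_or eq_sym k2 eq_sym.
      by apply: imset_f; rewrite !inE negb_or nik.
    by have [] := hJ _ AJ; rewrite cards2 k1.
  by move: kin; rewrite in_set2 => /orP[]/eqP <-; rewrite yk domy; [left|right].
case=> /andP[yk domy]; split=> //.
  exact: (above_but_notin ne eqm i1in).
exact: (above_but_notin ne eqm i2in).
Qed.

End Door.

Lemma card_pair_set (A B : finType) (P : pred (A * B)) :
  #|[set p | P p]| = \sum_a #|[set b | P (a, b)]|.
Proof.
rewrite -sum1dep_card; under [RHS]eq_bigr do rewrite -sum1dep_card.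
by rewrite pair_big_dep /=; apply: eq_bigl => -[].
Qed.

Lemma odd_sum (A : finType) (D : {set A}) (F : A -> nat) x0 : x0 \in D ->
  odd (F x0) -> (forall x, x \in D -> x != x0 -> ~~ odd (F x)) ->
  odd (\sum_(x in D) F x).
Proof.
move=> x0D ox0 h; rewrite (bigD1 x0) //= oddD ox0 /=.
rewrite -dvdn2; apply: dvdn_sum => x /andP[xD ne]; rewrite dvdn2; exact: h.
Qed.

Variables (slack : I -> Y) (c : Y -> I) (x0 : Y).
Hypothesis c_slack : forall i, c (slack i) = i.
Hypothesis slack_low : forall i y, r i (slack i) <= r i y.
Hypothesis slack_high : forall i j y, j != i -> y \notin slack @: setT ->
  r i y < r i (slack j).
Hypothesis x0_proper : x0 \notin slack @: setT.
Hypothesis I_gt1 : 1 < #|I|.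

Section Colored.
Variable i0 : I.

Definition colored_doors := [set A : {set Y} |
  [&& #|A|.+1 == #|I|, dominant A & c @: A == [set~ i0]]].

Definition outer_door := slack @: [set~ i0].

Lemma door_argmin (A : {set Y}) : #|A|.+1 = #|I| -> exists m : I -> Y,
  (forall i, m i \in A) /\ (forall i t, t \in A -> r i (m i) <= r i t).
Proof.
move=> cA; have /card_gt0P[t0 t0A] : 0 < #|A| by rewrite -ltnS cA.
exists (fun i => [arg min_(t < t0 | t \in A) r i t]).
by split=> [i|i t tA]; case: arg_minnP => // u uA; apply.
Qed.

Lemma slack_inj : injective slack. Proof. exact: can_inj c_slack. Qed.

Lemma card_outer_door : #|outer_door|.+1 = #|I|.
Proof. by rewrite (card_imset _ slack_inj) cardsC1 prednK // ltnW. Qed.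

Lemma outer_door_colored : outer_door \in colored_doors.
Proof.
rewrite inE card_outer_door eqxx /=; apply/andP; split.
  apply/dominantP => z; have [/imsetP[j _ ->]|zX] := boolP (z \in slack @: setT).
    by exists j => t _; exact: slack_low.
  by exists i0 => t /imsetP[j]; rewrite !inE => ji ->; apply: ltnW; exact: slack_high.
rewrite -imset_comp; apply/eqP; rewrite -[RHS]imset_id; apply: eq_imset => i.
exact: c_slack.
Qed.

(** The minimum for j != i0 is [slack j], so the collision is between i0 and the k with
    [m i0 = slack k]. The point [x0] lies in [above_but m i0]. The set [above_but m k] is empty:
    only slacks exceed [slack k] in order i0, and [slack l] does not exceed itself in order l. *)
Lemma odd_outer_extension :
  odd #|[set y | (y \notin outer_door) && dominant (y |: outer_door)]|.
Proof.
have cT := card_outer_door.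
have := outer_door_colored; rewrite inE => /and3P[_ domT _].
have [m [m_in m_min]] := door_argmin cT.
have mE j : j != i0 -> m j = slack j.
  move=> ji; apply: (@r_inj j); apply/eqP; rewrite eqn_leq slack_low andbT m_min //.
  by apply: imset_f; rewrite !inE.
have [k ki mk] : exists2 k, k != i0 & m i0 = slack k.
  by have /imsetP[k] := m_in i0; rewrite !inE => ki ->; exists k.
rewrite (@card_extensions _ m domT cT m_in m_min i0 k); first last.
- by rewrite mk mE.
- by rewrite eq_sym.
have -> : above_but m i0 != set0.
  apply/set0Pn; exists x0; apply/above_butP => j ji; rewrite mE //.
  rewrite ltn_neqAle slack_low andbT; apply: contra x0_proper => /eqP /r_inj <-.
  exact: imset_f.
have -> : above_but m k = set0.
  apply/setP => y; rewrite in_set0; apply/negbTE/negP => /above_butP yk.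
  have := yk i0; rewrite eq_sym ki mk => /(_ isT) yi0.
  have [/imsetP[l _ yE]|yX] := boolP (y \in slack @: setT); last first.
    by have := slack_high ki yX; rewrite ltnNge ltnW.
  have li : l != i0.
    by apply: contraTneq yi0 => li; rewrite yE li -leqNgt slack_low.
  have lk : l != k by apply: contraTneq yi0 => lk; rewrite yE lk ltnn.
  by have := yk l lk; rewrite mE // yE ltnn.
by rewrite eqxx.
Qed.

(** A colored door made of slacks only is the outer door. Any other one contains a non-slack x, and
    x bounds the minima so low that [slack k] belongs to [above_but m k] for every k; both terms of
    the count are 1. *)
Lemma even_inner_extension A : A \in colored_doors -> A != outer_door ->
  ~~ odd #|[set y | (y \notin A) && dominant (y |: A)]|.
Proof.
rewrite inE => /and3P[/eqP cA domA /eqP colA] AT.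
have [m [m_in m_min]] := door_argmin cA.
have [x xA xX] : exists2 x, x \in A & x \notin slack @: setT.
  apply/subsetPn; apply: contra AT => /subsetP Asl.
  rewrite eqEcard -ltnS -[_ < _]/(_ <= _) card_outer_door cA leqnn andbT.
  apply/subsetP => t tA; have /imsetP[i _ tE] := Asl t tA.
  rewrite tE; apply: imset_f; rewrite -(c_slack i) -tE -colA; exact: imset_f.
have nonempty k : above_but m k != set0.
  apply/set0Pn; exists (slack k); apply/above_butP => j jk.
  by apply: leq_ltn_trans (m_min j _ xA) _; apply: slack_high; rewrite 1?eq_sym.
have [i1 [i2 [ne eqm _]]] := door_collision domA cA m_in m_min.
by rewrite (card_extensions domA cA m_in m_min ne eqm) !nonempty.
Qed.

(** If W lacks a color and removing t leaves a colored door, then the color of t occurs at exactly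
    one other point t'. Removing t or t' leaves a colored door, removing anything else does not. *)
Lemma even_room (W : {set Y}) : c @: W != setT ->
  ~~ odd #|[set t | [&& t \in W, dominant W & W :\ t \in colored_doors]]|.
Proof.
move=> nfull; set Q := [set t | _].
have [->|/set0Pn[t]] := eqVneq Q set0; first by rewrite cards0.
rewrite inE => /and3P[tW domW]; rewrite inE => /and3P[/eqP cWt _ /eqP colW].
have inj s : #|W :\ s|.+1 = #|I| -> c @: (W :\ s) = [set~ i0] ->
    {in W :\ s &, injective c}.
  by move=> cs cols; apply/imset_injP; rewrite cols cardsC1 -cs.
have ct : c t != i0.
  apply: contra nfull => /eqP ct; rewrite -(setD1K tW) imsetU1 colW ct.
  by apply/eqP/setP => i; rewrite !inE orbN.
have /imsetP[t' t'W ctt'] : c t \in c @: (W :\ t) by rewrite colW !inE.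
have /setD1P[t't t'W'] := t'W.
rewrite (_ : Q = [set t; t']) ?cards2 1?eq_sym ?t't //.
apply/setP => s; rewrite inE !in_set2; apply/and3P/orP.
  case=> sW _; rewrite inE => /and3P[/eqP cs _ /eqP cols].
  apply/orP; apply: contraT; rewrite negb_or => /andP[st st'].
  move: (inj s cs cols t t'); rewrite !in_setD1 tW t'W' !andbT ![_ == s]eq_sym.
  by move=> /(_ st st' ctt') tt'; rewrite tt' eqxx in t't.
have cols' : c @: (W :\ t') = c @: (W :\ t).
  apply/eqP; rewrite eqEsubset; apply/andP; split; apply/subsetP => i /imsetP[u];
    rewrite !in_setD1 => /andP[ne uW] ->.
    have [->|ut] := eqVneq u t; first by rewrite ctt' imset_f.
    by apply: imset_f; rewrite in_setD1 ut.
  have [->|ut] := eqVneq u t'; last by apply: imset_f; rewrite in_setD1 ut.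
  by rewrite -ctt'; apply: imset_f; rewrite in_setD1 eq_sym t't.
have cW : #|W| = #|I| by rewrite (cardsD1 t) tW -cWt.
case=> /eqP ->; split=> //; rewrite inE.
  by rewrite cWt eqxx colW eqxx (dominantS _ domW) // subD1set.
rewrite cols' colW eqxx (dominantS _ domW) ?subD1set // !andbT.
by have := cardsD1 t' W; rewrite t'W' cW => ->.
Qed.

End Colored.

(** The pairs of a colored door and a point extending it to a room are counted twice. Door by door
    the total is odd; room by room it would be even if no room carried all colors. *)
Theorem scarf : exists W : {set Y},
  [/\ dominant W, c @: W = setT & #|W| = #|I|].
Proof.
have /card_gt0P[i0 _] : 0 < #|I| by exact: ltnW.
pose Q := [set q : {set Y} * Y |
  [&& q.2 \in q.1, dominant q.1 & q.1 :\ q.2 \in colored_doors i0]].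
pose P := [set p : {set Y} * Y |
  [&& p.1 \in colored_doors i0, p.2 \notin p.1 & dominant (p.2 |: p.1)]].
have PQ : #|P| = #|Q|.
  have <- : (fun p => (p.2 |: p.1, p.2)) @: P = Q.
    apply/setP => -[W t]; apply/imsetP/idP => [[[A y]]|].
      rewrite in_set /= => /and3P[AD yA domy] [-> ->].
      by rewrite in_set /= setU11 domy setU1K.
    rewrite in_set /= => /and3P[tW domW Wt].
    exists (W :\ t, t) => /=; last by rewrite setD1K.
    by rewrite in_set /= Wt setD11 setD1K.
  rewrite card_in_imset // => -[A y] [B z]; rewrite !in_set /=.
  move=> /and3P[_ yA _] /and3P[_ zB _] [AB yz]; subst z.
  by rewrite -(setU1K yA) AB setU1K.
have oddP : odd #|P|.
  rewrite card_pair_set /= (bigID (mem (colored_doors i0))) /= addnC big1 ?add0n.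
    apply: odd_sum (outer_door_colored i0) _ _ => [|A AD].
      have := odd_outer_extension i0; congr (odd _); apply: eq_card => y.
      by rewrite [LHS]in_set [RHS]in_set /= outer_door_colored.
    move=> ne; have := even_inner_extension AD ne; congr (~~ odd _).
    by apply: eq_card => y; rewrite [LHS]in_set [RHS]in_set /= AD.
  move=> A /negbTE AD; apply/eqP; rewrite cards_eq0; apply/eqP/setP => y.
  by rewrite in_set AD in_set0.
have /existsP[W] : [exists W : {set Y}, odd #|[set t | [&& t \in W, dominant W & W :\ t \in colored_doors i0]]|].
  apply: contraTT oddP; rewrite negb_exists => /forallP even.
  by rewrite PQ card_pair_set /= -dvdn2; apply: dvdn_sum => W _; rewrite dvdn2.
move=> oddW; exists W.
have full : c @: W == setT by apply: contraTT oddW; exact: even_room.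
have /set0Pn[t] : [set t | [&& t \in W, dominant W & W :\ t \in colored_doors i0]] != set0.
  by apply: contraTneq oddW => ->; rewrite cards0.
rewrite in_set => /and3P[tW domW]; rewrite inE => /and3P[/eqP cW _ _].
by split=> //; [exact/eqP|rewrite (cardsD1 t) tW -cW].
Qed.

End Scarf.

From mathcomp Require Import all_classical all_reals all_analysis.

Import numFieldNormedType.Exports.

Local Open Scope classical_set_scope.
Local Open Scope ring_scope.

(** * Scarf's lemma on the integer grid of a simplex *)

Section GridScarf.
Local Open Scope nat_scope.
Variables (I : finType) (K : nat) (col : {ffun I -> 'I_K.+1} -> I).
Hypothesis I_gt1 : 1 < #|I|.
Hypothesis I_leK : #|I| <= K.

Let grid := {z : {ffun I -> 'I_K.+1} | \sum_i z i == K}.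
Let Y := (I + grid)%type.

(** Order i reads the i-th coordinate of a grid point. The shift by one leaves 0 for the slack of i,
    and K + 2 puts the other slacks above all grid points, whose levels are at most K + 1. *)
Let level (i : I) (y : Y) : nat :=
  match y with inl j => if j == i then 0 else K.+2 | inr z => (sval z i).+1 end.

(* Ties between points of equal level are broken by their enumeration rank. *)
Let rk (i : I) (y : Y) := level i y * #|{: Y}| + enum_rank y.

Let rk_inj i : injective (rk i).
Proof.
move=> y y' /(congr1 (modn^~ #|{: Y}|)).
by rewrite !modnMDl !modn_small ?ltn_ord // => /val_inj /enum_rank_inj.
Qed.

Let ltn_rk i y y' : level i y < level i y' -> rk i y < rk i y'.
Proof.
move=> lt; apply: (@leq_trans ((level i y).+1 * #|{: Y}|)).
  by rewrite /rk mulSn addnC ltn_add2r ltn_ord.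
by apply: leq_trans (leq_addr _ _); rewrite leq_mul2r lt orbT.
Qed.

Let leq_level i y y' : rk i y <= rk i y' -> level i y <= level i y'.
Proof. by apply: contraTT; rewrite -!ltnNge; exact: ltn_rk. Qed.

Let grid_above (mu : I -> nat) : \sum_i mu i <= K ->
  exists z : grid, forall i, mu i <= sval z i.
Proof.
move=> leK; have /card_gt0P[i0 _] : 0 < #|I| by exact: ltnW.
pose zn i := mu i + (if i == i0 then K - \sum_i mu i else 0).
have zsum : \sum_i zn i = K.
  rewrite big_split /= -big_mkcond /= big_pred1_eq; lia.
have zlt i : zn i < K.+1.
  by rewrite ltnS -[X in _ <= X]zsum (bigD1 i) //= leq_addr.
have sz : \sum_i [ffun i => Ordinal (zlt i)] i == K.
  by rewrite -[X in _ == X]zsum; apply/eqP; apply: eq_bigr => i _; rewrite ffunE.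
exists (exist (fun z : {ffun I -> 'I_K.+1} => \sum_i z i == K) _ sz) => i /=.
by rewrite ffunE /= leq_addr.
Qed.

(** [mu] collects the coordinatewise minima of a fully colored room. Color i is carried either by
    the slack of i, and then [mu i] is 0, or by a grid point of the room, which lies above [mu]. If
    the sum were at most K minus the size of I, some grid point would exceed [mu] in every
    coordinate, against dominance. *)
Lemma grid_scarf : exists mu : I -> nat,
  [/\ \sum_i mu i <= K, K < \sum_i mu i + #|I| &
   forall i, (mu i = 0) \/ exists z : {ffun I -> 'I_K.+1},
     [/\ \sum_j z j = K, col z = i & forall j, mu j <= z j]].
Proof.
have /card_gt0P[i0 _] : 0 < #|I| by exact: ltnW.
have [g0 _] : exists z : grid, forall i, 0 <= sval z i.
  by apply: grid_above; rewrite big1.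
pose c (y : Y) := match y with inl j => j | inr z => col (sval z) end.
have proper (z : grid) : inr z \notin (inl : I -> Y) @: [set: I]%SET.
  by apply/imsetP => -[].
have [W [/(dominantP _ _) domW cW cardW]] : exists W : {set Y},
    [/\ dominant rk W, c @: W = [set: I]%SET & #|W| = #|I|].
  refine (@scarf I Y rk rk_inj inl c (inr g0) _ _ _ _ _) => //.
  - move=> i [j|z]; last by apply: ltnW; apply: ltn_rk; rewrite /= eqxx.
    have [->//|ne] := eqVneq j i.
    by apply: ltnW; apply: ltn_rk; rewrite /= eqxx (negbTE ne).
  - move=> i j [k|z] ji yX; first by case/negP: yX; apply: imset_f; rewrite inE.
    by apply: ltn_rk; rewrite /= (negbTE ji) ltnS ltn_ord.
have /card_gt0P[w0 w0W] : 0 < #|W| by rewrite cardW; exact: ltnW.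
pose m i := [arg min_(t < w0 | t \in W) rk i t].
have m_in i : m i \in W by rewrite /m; case: arg_minnP.
have m_min i t : t \in W -> level i (m i) <= level i t.
  move=> tW; apply: leq_level; rewrite /m; case: arg_minnP => // u _; exact.
pose mu i := (level i (m i)).-1.
have hmu i : (mu i = 0) \/ exists z : {ffun I -> 'I_K.+1},
     [/\ \sum_j z j = K, col z = i & forall j, mu j <= z j].
  have : i \in c @: W by rewrite cW inE.
  case/imsetP => -[j|[z zK]] wW /= ->; [left|right].
    by rewrite /mu; have := m_min j _ wW; rewrite /= eqxx leqn0 => /eqP ->.
  exists z; split=> //; first exact/eqP.
  by move=> j; have := m_min j _ wW; rewrite /mu /= -ltnS; lia.
exists mu; split=> //; last first.
  rewrite ltnNge; apply/negP => leK.
  have [|z hz] := grid_above (mu := fun i => (mu i).+1).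
    by under eq_bigr do rewrite -addn1; rewrite big_split /= sum1_card.
  have [i /(_ _ (m_in i))/leq_level /=] := domW (inr z).
  by have := hz i; rewrite /mu; lia.
have [/forallP h0|] := boolP [forall i, mu i == 0].
  by rewrite big1 // => i _; apply/eqP.
rewrite negb_forall => /existsP[i /eqP hi].
have [//|[z [zK _ hz]]] := hmu i.
by rewrite -[X in _ <= X]zK; apply: leq_sum.
Qed.

End GridScarf.

(** * Limits along ultrafilters and Brouwer's theorem *)

(** Compactness gives a cluster point, and an ultrafilter converges to each of its cluster points.
    Limits along one fixed ultrafilter exist for all bounded sequences simultaneously, without
    passing to subsequences. *)
Lemma ultra_bounded_cvg (R : realType) (F : set_system nat) (u : nat -> R) a b :
  UltraFilter F -> (\forall k \near F, a <= u k <= b) ->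
  exists l : R, u k @[k --> F] --> l.
Proof.
move=> FU hu; have FF := @ultra_proper _ F FU.
have [|l [_ cl]] := @segment_compact R a b (u k @[k --> F]) _.
  by near=> k; rewrite /= in_itv /=; near: k.
exists l; apply/cvgrPdist_lt => e e0.
have [//|nF] := in_ultra_setVsetC [set k | `|l - u k| < e] FU.
have [||y []] := cl [set x | ~ `|l - x| < e] [set x | `|l - x| < e]; first exact: nF.
  exact: nbhsx_ballx.
by [].
Unshelve. all: by end_near. Qed.

Lemma cvg_sum_fin (R : realType) (I : finType) (F : set_system nat)
    (FF : Filter F) (u : nat -> I -> R) (x : I -> R) :
  (forall i, u k i @[k --> F] --> x i) ->
  \sum_i u k i @[k --> F] --> \sum_i x i.
Proof.
move=> h; apply: (@cvg_big R I +%R 0 predT _ nat F (index_enum I) (fun i k => u k i)) => //.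
exact: add_continuous.
Qed.

Definition simplex (R : realType) (I : finType) (x : I -> R) :=
  (forall i, 0 <= x i) /\ \sum_i x i = 1.

Section Brouwer.
Variables (R : realType) (I : finType) (f : (I -> R) -> I -> R).
Hypothesis I_gt1 : (1 < #|I|)%N.
Hypothesis f_simplex : forall x, simplex x -> simplex (f x).
Hypothesis f_cont : forall (F : set_system nat) (u : nat -> I -> R) x,
  ProperFilter F -> (forall k, simplex (u k)) -> simplex x ->
  (forall i, u k i @[k --> F] --> x i) ->
  forall i, f (u k) i @[k --> F] --> f x i.

Let scale K (z : {ffun I -> 'I_K.+1}) (i : I) : R := (z i : nat)%:R / K%:R.

Let scale_simplex K (z : {ffun I -> 'I_K.+1}) : (0 < K)%N ->
  (\sum_i z i)%N = K -> simplex (scale z).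
Proof.
move=> K0 zK; split=> [i|]; first by rewrite divr_ge0.
by rewrite -mulr_suml -natr_sum zK divff // pnatr_eq0 -lt0n.
Qed.

(** Both coordinate sums are 1, so not every coordinate can strictly decrease. An index of this kind
    serves as the color of a grid point. *)
Let label_exists x : simplex x -> exists i, x i <= f x i.
Proof.
move=> sx; have [_ fx1] := f_simplex sx; have [_ x1] := sx.
apply/not_existsP => h.
suff : \sum_i f x i < \sum_i x i by rewrite fx1 x1 ltxx.
have /card_gt0P[i0 _] : (0 < #|I|)%N by exact: ltnW.
apply: ltr_sum => [|i _]; last by rewrite ltNge; apply/negP; exact: h.
by apply/hasP; exists i0; rewrite ?mem_index_enum.
Qed.

Let approx K : (#|I| <= K)%N -> exists mu : I -> nat,
  [/\ (\sum_i mu i <= K)%N, (K < \sum_i mu i + #|I|)%N &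
   forall i, (mu i = 0%N) \/ exists y,
     [/\ simplex y, y i <= f y i &
        forall j, (mu j)%:R / K%:R <= y j <= (mu j)%:R / K%:R + #|I|%:R / K%:R]].
Proof.
move=> IK; have K0 : (0 < K)%N by apply: leq_trans IK; exact: ltnW.
have /card_gt0P[i0 _] : (0 < #|I|)%N by exact: ltnW.
pose col (z : {ffun I -> 'I_K.+1}) := if pselect (simplex (scale z)) is left p
              then projT1 (cid (label_exists p)) else i0.
have [mu [mu1 mu2 hmu]] := @grid_scarf I K col I_gt1 IK.
exists mu; split=> // i; have [->|[z [zK ci hz]]] := hmu i; [by left|right].
have sz := scale_simplex K0 zK.
exists (scale z); split=> // [|j].
  move: ci; rewrite /col; case: pselect => [p|//].
  by case: cid => /= j hj <-.
rewrite -mulrDl -natrD !ler_pdivlMr ?ltr0n // mulfVK ?pnatr_eq0 -?lt0n //.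
(* z exceeds [mu] by less than the size of I in coordinate j: it is above [mu] in the other
   coordinates, and the sum of [mu] is larger than K minus that size. *)
rewrite /scale mulfVK ?pnatr_eq0 -?lt0n // !ler_nat hz /= -(leq_add2r (\sum_(k | k != j) mu k)).
have : (\sum_(k | k != j) mu k <= \sum_(k | k != j) z k)%N by exact: leq_sum.
by move: zK mu2; rewrite !(bigD1 j (P := predT)) //=; lia.
Qed.

(** Let x be the ultralimit of [mu / K]. For each i, either [mu i] vanishes on a set of F and x i =
    0, or the grid points of color i also tend to x and the inequality defining the color passes to
    the limit. So x <= f x coordinatewise, and equal sums force equality. *)
Theorem brouwer_simplex : exists2 x, simplex x & forall i, f x i = x i.
Proof.
have /card_gt0P[i0 _] : (0 < #|I|)%N by exact: ltnW.
pose K k := (k + #|I|)%N.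
have IK k : (#|I| <= K k)%N by rewrite leq_addl.
have K0 k : (0 < K k)%N by apply: leq_trans (IK k); exact: ltnW.
have KR k : 0 < (K k)%:R :> R by rewrite ltr0n.
have [mu hmu] := choice (fun k => approx (IK k)).
have mule k i : (mu k i <= K k)%N.
  by have [+ _ _] := hmu k; apply: leq_trans; rewrite (bigD1 i) //= leq_addr.
have [F [FU Foo]] := @ultraFilterLemma _ (nbhs \oo) _.
have FF := @ultra_proper _ F FU.
have invK0 : (#|I|%:R / (K k)%:R : R) @[k --> F] --> 0.
  suff h : (#|I|%:R / (K k)%:R : R) @[k --> \oo] --> 0 by move=> A /h; exact: Foo.
  have h1 : (#|I|%:R * harmonic k : R) @[k --> \oo] --> 0.
    by rewrite -[X in _ --> X](mulr0 #|I|%:R); apply: cvgMl_tmp; exact: cvg_harmonic.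
  apply: (squeeze_cvgr _ (cvg_cst 0) h1); near=> k; rewrite divr_ge0 //=.
  by rewrite ler_pM2l ?ltr0n 1?ltnW // lef_pV2 ?posrE ?ltr0n // ler_nat /K; lia.
have bnd i : exists l : R, ((mu k i)%:R / (K k)%:R : R) @[k --> F] --> l.
  apply: (@ultra_bounded_cvg _ _ _ 0 1) => //; near=> k.
  by rewrite divr_ge0 //= ler_pdivrMr // mul1r ler_nat.
have [x hx] := choice bnd.
have x_ge0 i : 0 <= x i.
  by apply: (cvgr_to_ge (hx i)); near=> k; rewrite divr_ge0.
have sumx : \sum_i x i = 1.
  have h : (\sum_i ((mu k i)%:R / (K k)%:R : R)) @[k --> F] --> \sum_i x i.
    exact: cvg_sum_fin.
  apply/eqP; rewrite eq_le; apply/andP; split.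
    apply: (cvgr_to_le h); near=> k; rewrite -mulr_suml -natr_sum.
    by rewrite ler_pdivrMr // mul1r ler_nat; have [] := hmu k.
  have h2 : (\sum_i ((mu k i)%:R / (K k)%:R : R) + #|I|%:R / (K k)%:R) @[k --> F]
      --> \sum_i x i + 0 by exact: cvgD.
  rewrite -[leRHS]addr0; apply: (cvgr_to_ge h2); near=> k => /=.
  rewrite -mulr_suml -mulrDl -natr_sum -natrD ler_pdivlMr // mul1r ler_nat ltnW //.
  by have [] := hmu k.
have sx : simplex x by [].
exists x => //.
have fx_ge i : x i <= f x i.
  have [F0|F0] := in_ultra_setVsetC [set k | mu k i = 0%N] FU.
    suff -> : x i = 0 by have [+ _] := f_simplex sx; apply.
    apply: cvg_unique (hx i) _ => //.
    by apply: cvg_near_cst; apply: filterS F0 => k /= ->; rewrite mul0r.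
  have yex k : exists y : I -> R, simplex y /\ (mu k i <> 0%N -> y i <= f y i /\
      forall j, (mu k j)%:R / (K k)%:R <= y j <=
                (mu k j)%:R / (K k)%:R + #|I|%:R / (K k)%:R).
    have [_ _ /(_ i)[mu0|[y [h1 h2 h3]]]] := hmu k; last by exists y.
    (* A placeholder vertex for the k with [mu k i = 0], which form a set outside the filter in this
       case. *)
    exists (fun j => (j == i0)%:R); split=> //; split=> [j|]; first by case: eqP.
    by rewrite -natr_sum -big_mkcond big_pred1_eq.
  have [y hy] := choice yex.
  have ycvg j : y k j @[k --> F] --> x j.
    have hx' : ((mu k j)%:R / (K k)%:R + #|I|%:R / (K k)%:R : R) @[k --> F] --> x j.
      by rewrite -[X in _ --> X]addr0; exact: cvgD.
    apply: (squeeze_cvgr _ (hx j) hx').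
    by apply: filterS F0 => k /= /(proj2 (hy k))[_ ]; exact.
  have := f_cont _ (fun k => proj1 (hy k)) sx ycvg => /(_ _ i) fcvg.
  apply: (ler_cvg_to (ycvg i) fcvg).
  by apply: filterS F0 => k /= /(proj2 (hy k))[].
have := f_simplex sx; case=> _ fx1 i; apply/eqP; rewrite eq_le fx_ge andbT.
have := fx1; rewrite -sumx !(bigD1 i (P := predT)) //=.
have : \sum_(j | j != i) x j <= \sum_(j | j != i) f x j by apply: ler_sum.
lra.
Unshelve. all: by end_near. Qed.

End Brouwer.

Section BrouwerCorner.
Variables (R : realType) (J : finType) (M : R) (g : (J -> R) -> J -> R).
Let corner (x : J -> R) := (forall j, 0 <= x j) /\ \sum_j x j <= M.
Hypothesis J_gt0 : (0 < #|J|)%N.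
Hypothesis M_gt0 : 0 < M.
Hypothesis g_corner : forall x, corner x -> corner (g x).
Hypothesis g_cont : forall (F : set_system nat) (u : nat -> J -> R) x,
  ProperFilter F -> (forall k, corner (u k)) -> corner x ->
  (forall j, u k j @[k --> F] --> x j) ->
  forall j, g (u k) j @[k --> F] --> g x j.

Let sum_option (y : option J -> R) : \sum_i y i = y None + \sum_j y (Some j).
Proof.
rewrite (bigD1 None) //=; congr (_ + _).
rewrite (reindex_omap Some id) /=; last by case.
by apply: eq_bigl => j; rewrite eqxx.
Qed.

Theorem brouwer_corner : exists2 x, corner x & forall j, g x j = x j.
Proof.
pose ext (y : option J -> R) (j : J) := M * y (Some j).
have ext_corner y : simplex y -> corner (ext y).
  move=> [y0 y1]; split=> [j|]; first by rewrite mulr_ge0 // ltW.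
  rewrite -mulr_sumr -[leRHS]mulr1 ler_pM2l // -y1 sum_option.
  by rewrite lerDr.
pose f (y : option J -> R) i := if i is Some j then g (ext y) j / M
  else 1 - \sum_j (g (ext y) j / M).
have g_ext (F : set_system nat) (u : nat -> option J -> R) x j : ProperFilter F ->
    (forall k, simplex (u k)) -> simplex x ->
    (forall i, u k i @[k --> F] --> x i) ->
    (g (ext (u k)) j / M : R) @[k --> F] --> g (ext x) j / M.
  move=> FF su sx ux; apply: cvgMr_tmp; apply: g_cont.
  - by move=> k; exact: ext_corner.
  - exact: ext_corner.
  - by move=> i; apply: cvgMl_tmp; exact: ux.
have [||F u x FF su sx ux [j|]|x sx fx] := @brouwer_simplex R (option J) f.
- by rewrite card_option.
- move=> y /ext_corner /g_corner[g0 g1]; split=> [[j|]|].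
  + by rewrite divr_ge0 // ltW.
  + by rewrite subr_ge0 -mulr_suml ler_pdivrMr // mul1r.
  + by rewrite sum_option /= subrK.
- exact: g_ext.
- by apply: cvgB; [exact: cvg_cst|apply: cvg_sum_fin => j; exact: g_ext].
exists (ext x); first exact: ext_corner.
by move=> j; have := fx (Some j); rewrite /f /ext => <-; rewrite mulrCA divff ?mulr1 // gt_eqF.
Qed.

End BrouwerCorner.

(** * Integrals over segments *)

Local Notation seg_int a b f := (Rintegral lebesgue_measure `[a, b] f).

Section SegmentIntegral.
Variable R : realType.
Implicit Types (a b c : R) (f g : R -> R).

Lemma continuous_seg_integrable f a b : continuous f ->
  lebesgue_measure.-integrable `[a, b] (EFin \o f).
Proof.
move=> cf; apply: continuous_compact_integrable; first exact: segment_compact.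
exact: continuous_subspaceT.
Qed.

Lemma seg_intD f g a b : continuous f -> continuous g ->
  seg_int a b (fun x => f x + g x) = seg_int a b f + seg_int a b g.
Proof. by move=> cf cg; rewrite RintegralD //; exact: continuous_seg_integrable. Qed.

Lemma seg_intZ f a b c : continuous f ->
  seg_int a b (fun x => c * f x) = c * seg_int a b f.
Proof. by move=> cf; rewrite RintegralZl //; exact: continuous_seg_integrable. Qed.

Lemma seg_int_cst a b c : a <= b -> seg_int a b (fun=> c) = c * (b - a).
Proof.
move=> ab; rewrite Rintegral_cst //= lebesgue_measure_itv /= lte_fin.
case: ltP => [//|ba]; have -> : b = a by apply/eqP; rewrite eq_le ba ab.
by rewrite subrr.
Qed.

Lemma le_seg_int f g a b : continuous f -> continuous g ->
  (forall x, a <= x <= b -> f x <= g x) -> seg_int a b f <= seg_int a b g.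
Proof.
move=> cf cg fg; apply: le_Rintegral => //; try exact: continuous_seg_integrable.
Qed.

Lemma seg_int_cat f a b c : continuous f -> a <= b -> b <= c ->
  seg_int a c f = seg_int a b f + seg_int b c f.
Proof.
move=> cf ab bc; rewrite -(@Rintegral_itv_obnd_cbnd R b (BRight c)); last first.
  by apply: integrableS (continuous_seg_integrable b c cf) => //; apply: subset_itvr; rewrite bnd_simp.
have h := @Rintegral_itvB R f (BLeft a) (BRight c) b (continuous_seg_integrable a c cf).
by rewrite -h ?bnd_simp // addrC subrK.
Qed.

Lemma eq_seg_int f g a b : (forall x, a <= x <= b -> f x = g x) ->
  seg_int a b f = seg_int a b g.
Proof.
by move=> fg; apply: eq_Rintegral => x; rewrite inE /= in_itv; exact: fg.
Qed.

Lemma seg_int_le_dist f a b c e : continuous f -> a <= b ->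
  (forall x, a <= x <= b -> `|f x - c| <= e) ->
  `|seg_int a b f - c * (b - a)| <= e * (b - a).
Proof.
move=> cf ab h; rewrite ler_norml lerBrDr lerBlDr -mulNr -!mulrDl.
rewrite -!(seg_int_cst _ ab); apply/andP; split; apply: le_seg_int => //;
  try exact: cst_continuous; move=> x /h; rewrite ler_norml; lra.
Qed.

Lemma is_derive_seg_int f a t : continuous f -> a < t ->
  is_derive t 1 (fun x => seg_int a x f) (f t).
Proof.
move=> cf lt; have [||//||h1 h2] := @continuous_FTC1_closed R f a t (t + 1).
- by rewrite ltrDl.
- exact: continuous_seg_integrable.
- exact: cf.
by rewrite -h2 derive1E; exact: derivableP.
Qed.

Lemma seg_int_sum f (d : R) n : continuous f -> 0 <= d ->
  seg_int 0 (d * n%:R) f =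
  \sum_(j < n) seg_int (d * j%:R) (d * j.+1%:R) f.
Proof.
move=> cf d0; elim: n => [|n IHn].
  by rewrite big_ord0 mulr0 set_itv1 Rintegral_set1.
rewrite big_ord_recr /= -IHn; apply: seg_int_cat => //; first by rewrite mulr_ge0.
by rewrite ler_wpM2l // ler_nat.
Qed.

Lemma seg_int_id a b : a <= b -> seg_int a b id = (b ^+ 2 - a ^+ 2) / 2.
Proof.
move=> ab; have [->|ne] := eqVneq a b.
  by rewrite set_itv1 Rintegral_set1; lra.
have lt : a < b by rewrite lt_neqAle ne.
have dF (x : R) : is_derive x 1 (fun y : R => 2^-1 * y ^+ 2) x.
  by apply: is_derive_eq; rewrite /GRing.scale /=; lra.
have cF : continuous (fun y : R => 2^-1 * y ^+ 2).
  by move=> x; apply: differentiable_continuous; by apply/derivable1_diffP; have [] := dF x.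
have := @continuous_FTC2 R id (fun y => 2^-1 * y ^+ 2) a b lt.
rewrite /Rintegral => -> //=.
- by lra.
- by apply: continuous_subspaceT => x; exact: cvg_id.
- split=> [x _||]; [by have [] := dF x|apply: cvg_at_right_filter|apply: cvg_at_left_filter]; exact: cF.
- by move=> x _; rewrite derive1E; have [_ ->] := dF x.
Qed.

Lemma seg_int_affine a b c d : a <= b ->
  seg_int a b (fun x => c + d * x) = c * (b - a) + d * ((b ^+ 2 - a ^+ 2) / 2).
Proof.
move=> ab; have cid : continuous (id : R -> R) by move=> x; exact: cvg_id.
rewrite (@seg_intD (fun=> c) (fun x => d * x)); first last.
- by move=> x; apply: cvgMl_tmp; exact: cvg_id.
- exact: cst_continuous.
by rewrite seg_int_cst // (@seg_intZ id) // seg_int_id.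
Qed.

End SegmentIntegral.

(** * Sup norm and uniform convergence along an ultrafilter *)

Section SupNorm.
Variables (R : realType) (T : R).
Hypothesis T_ge0 : 0 <= T.
Implicit Types u v : R -> R.

Lemma sup_norm_ge u t : continuous u -> 0 <= t <= T -> `|u t| <= sup_norm T u.
Proof.
move=> cu tT; apply: ub_le_sup; last by exists t => //=; rewrite in_itv.
have cn : {within `[0, T], continuous (fun t => `|u t|)}.
  by apply: continuous_subspaceT => x; apply: cvg_norm; exact: cu.
have [c _ hc] := EVT_max T_ge0 cn.
by exists `|u c| => _ [x xT <-]; exact: hc.
Qed.

Lemma sup_norm_le u c : (forall t, 0 <= t <= T -> `|u t| <= c) ->
  sup_norm T u <= c.
Proof.
move=> h; apply: ge_sup; first by exists `|u 0|; exists 0 => //=; rewrite in_itv /= lexx.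
by move=> _ [x /= + <-]; rewrite in_itv; exact: h.
Qed.

Lemma sup_norm_ge0 u : continuous u -> 0 <= sup_norm T u.
Proof. by move=> cu; apply: le_trans (normr_ge0 (u 0)) (sup_norm_ge cu _); rewrite lexx. Qed.

Lemma sup_norm_dist u v e : continuous u -> continuous v ->
  (forall t, 0 <= t <= T -> `|u t - v t| <= e) ->
  `|sup_norm T u - sup_norm T v| <= e.
Proof.
have main u' v' : continuous v' -> (forall t, 0 <= t <= T -> `|u' t - v' t| <= e) ->
    sup_norm T u' <= sup_norm T v' + e.
  move=> cv h; apply: sup_norm_le => t tT.
  have := sup_norm_ge cv tT; have := h t tT; have := ler_normD (u' t - v' t) (v' t).
  rewrite subrK; lra.
move=> cu cv h; have h1 := main u v cv h.
have h2 : sup_norm T v <= sup_norm T u + e by apply: main => // t tT; rewrite distrC h.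
rewrite ler_norml; apply/andP; split; lra.
Qed.

End SupNorm.

Section UltraLimit.
Variables (R : realType) (T : R) (F : set_system nat).
Hypothesis T_gt0 : 0 < T.
Hypothesis FU : UltraFilter F.
Hypothesis Foo : nbhs \oo `<=` F.
Let FF := @ultra_proper _ F FU.
Implicit Types (phi : nat -> R -> R) (psi : R -> R).

(* On the compact [0, T], convergence along moving points amounts to uniform
   convergence to a continuous limit. *)
Definition moving_cvg phi psi := forall (s : nat -> R) s0,
  (forall k, 0 <= s k <= T) -> 0 <= s0 <= T -> s k @[k --> F] --> s0 ->
  phi k (s k) @[k --> F] --> psi s0.

Let mesh_cvg : (T / k.+1%:R : R) @[k --> F] --> 0.
Proof.
suff h : (T / k.+1%:R : R) @[k --> \oo] --> 0 by move=> A /h; exact: Foo.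
by rewrite -[X in _ --> X](mulr0 T); apply: cvgMl_tmp; exact: cvg_harmonic.
Qed.

(** Otherwise violating pairs exist for k in a set of F. Their two components have the same
    ultralimit, as the mesh tends to 0, and convergence along moving points contradicts the gap e.
    Two points are compared so that a node value controls its whole mesh cell. *)
Lemma moving_cvg_uniform phi psi e : continuous psi ->
  moving_cvg phi psi -> 0 < e ->
  \forall k \near F, forall x y, 0 <= x <= T -> 0 <= y <= T ->
    `|x - y| <= T / k.+1%:R -> `|phi k x - psi y| < e.
Proof.
move=> cpsi hphi e0.
pose A := [set k | forall x y, 0 <= x <= T -> 0 <= y <= T ->
    `|x - y| <= T / k.+1%:R -> `|phi k x - psi y| < e].
have [//|nA] := in_ultra_setVsetC A FU.
have pk k : exists p : R * R, [/\ 0 <= p.1 <= T, 0 <= p.2 <= T &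
   A k \/ (`|p.1 - p.2| <= T / k.+1%:R /\ e <= `|phi k p.1 - psi p.2|)].
  have [Ak|nAk] := pselect (A k).
    by exists (0, 0); rewrite /= lexx (ltW T_gt0); split=> //; left.
  move/existsNP: nAk => [x /existsNP[y]] /not_implyP[xT] /not_implyP[yT].
  by move=> /not_implyP[xy] /negP; rewrite -leNgt => h; exists (x, y); split=> //; right.
have [p hp] := choice pk.
have p1T k : 0 <= (p k).1 <= T by have [] := hp k.
have p2T k : 0 <= (p k).2 <= T by have [] := hp k.
have nAE : \forall k \near F, `|(p k).1 - (p k).2| <= T / k.+1%:R /\
    e <= `|phi k (p k).1 - psi (p k).2|.
  by apply: filterS nA => k nAk; have [_ _ []] := hp k.
have [s0 hs0] := @ultra_bounded_cvg R F (fun k => (p k).1) 0 T FU (nearW _ p1T).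
have s0T : 0 <= s0 <= T.
  by apply/andP; split; [apply: (cvgr_to_ge hs0)|apply: (cvgr_to_le hs0)];
    apply: nearW => k; have /andP[] := p1T k.
have d0 : ((p k).2 - (p k).1 : R) @[k --> F] --> 0.
  apply/norm_cvg0P; apply: (squeeze_cvgr _ (cvg_cst 0) mesh_cvg).
  by apply: filterS nAE => k [h _]; rewrite normr_ge0 distrC.
have p2cvg : (p k).2 @[k --> F] --> s0.
  rewrite (_ : (fun k => (p k).2) = (fun k => (p k).1 + ((p k).2 - (p k).1))); last first.
    by apply/funext => k; rewrite addrC subrK.
  by rewrite -[X in _ --> X]addr0; exact: cvgD.
have c1 := hphi _ _ p1T s0T hs0.
have c2 : psi (p k).2 @[k --> F] --> psi s0 by apply: continuous_cvg p2cvg; exact: cpsi.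
have c3 : (phi k (p k).1 - psi (p k).2 : R) @[k --> F] --> 0.
  by rewrite -[X in _ --> X](subrr (psi s0)); exact: cvgB.
have /cvgr_dist_lt/(_ _ e0) c4 := c3.
have [k [[_ h1] h2]] := @filter_ex _ F _ _ (filterI nAE c4).
by move: h2; rewrite sub0r normrN ltNge h1.
Qed.

Lemma riemann_sum_cvg phi psi : continuous psi -> moving_cvg phi psi ->
  \sum_(j < k.+1) T / k.+1%:R * phi k (T / k.+1%:R * j.+1%:R) @[k --> F]
    --> seg_int 0 T psi.
Proof.
move=> cpsi hphi; apply/cvgrPdist_le => e e0.
have e1 : 0 < e / T by rewrite divr_gt0.
have := moving_cvg_uniform cpsi hphi e1.
apply: filterS => k hk.
set d := T / k.+1%:R.
have kR : 0 < k.+1%:R :> R by rewrite ltr0n.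
have d0 : 0 < d by rewrite divr_gt0.
have Td : d * k.+1%:R = T by rewrite /d mulfVK // gt_eqF.
have node (j : nat) : (j <= k.+1)%N -> 0 <= d * j%:R <= T.
  by move=> jk; rewrite mulr_ge0 ?(ltW d0) //= -[leRHS]Td ler_pM2l // ler_nat.
rewrite -{1}Td seg_int_sum //; last exact: ltW.
rewrite -sumrB; apply: le_trans (ler_norm_sum _ _ _) _.
have -> : e = \sum_(j < k.+1) (e / T * d).
  by rewrite sumr_const card_ord -[RHS]mulr_natr -mulrA Td mulfVK // gt_eqF.
(* On each cell the node value differs from psi by at most e / T, so a cell of length d contributes
   an error of at most e d / T. *)
apply: ler_sum => j _; rewrite [d * phi _ _]mulrC.
have len : d * j.+1%:R - d * j%:R = d by rewrite -natr1; ring.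
rewrite -[X in _ - phi _ _ * X]len -[X in _ <= _ * X]len.
apply: seg_int_le_dist => //; first by rewrite ler_pM2l // ler_nat.
move=> x /andP[x1 x2]; rewrite distrC ltW //.
have /andP[j1 _] := node j (ltnW (ltn_ord j)).
have /andP[j2 j3] := node j.+1 (ltn_ord j).
apply: hk; first by rewrite j2 j3.
  by rewrite (le_trans j1 x1) (le_trans x2 j3).
rewrite ger0_norm ?subr_ge0 // -/d -[leRHS]len; lra.
Qed.

End UltraLimit.

(** * Concavity and the Green function *)

(** The three-point inequality with denominators cleared, so that coinciding points need no separate
    treatment. *)
Definition concave_on (R : realType) (T : R) (u : R -> R) :=
  forall x y z, 0 <= x -> x <= y -> y <= z -> z <= T ->
    (z - y) * u x + (y - x) * u z <= (z - x) * u y.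

(** The graph lies above its chord on [0, eta], so the trapezoidal rule underestimates the
    integral. *)
Lemma concave_seg_int (R : realType) (T eta : R) (u : R -> R) :
  0 <= eta <= T -> continuous u -> concave_on T u ->
  eta * (u 0 + u eta) / 2 <= seg_int 0 eta u.
Proof.
move=> /andP[]; rewrite le_eqVlt => /predU1P[<- _ _ _|eta0 etaT cu hu].
  by rewrite set_itv1 Rintegral_set1 !mul0r.
have <- : seg_int 0 eta (fun x => u 0 + (u eta - u 0) / eta * x) =
    eta * (u 0 + u eta) / 2.
  by rewrite seg_int_affine ?ltW //; field; rewrite gt_eqF.
apply: le_seg_int => //.
  move=> x; apply: cvgD; first exact: cvg_cst.
  by apply: cvgMl_tmp; exact: cvg_id.
move=> x /andP[x0 xe]; have := hu 0 x eta (lexx 0) x0 xe etaT.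
rewrite !subr0 => h; rewrite -(ler_pM2l eta0); apply: le_trans h.
by rewrite le_eqVlt; apply/orP; left; apply/eqP; field; rewrite gt_eqF.
Qed.

Lemma minr_dist (R : realType) (a b c d e : R) : `|a - c| <= e -> `|b - d| <= e ->
  `|Num.min a b - Num.min c d| <= e.
Proof.
rewrite !ler_norml => /andP[? ?] /andP[? ?].
by case: (leP a b) => ?; case: (leP c d) => ?; apply/andP; split; lra.
Qed.

Section Green.
Variables (R : realType) (T : R).
Hypothesis T_gt0 : 0 < T.

(** The Green function of -u'' with zero values at 0 and T. Written as a minimum of two functions
    affine in t, it is visibly symmetric, concave and Lipschitz. *)
Definition green (t s : R) := Num.min (t * (T - s)) (s * (T - t)) / T.

Lemma green_ge0 t s : 0 <= t <= T -> 0 <= s <= T -> 0 <= green t s.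
Proof.
move=> /andP[t0 tT] /andP[s0 sT].
by rewrite divr_ge0 ?(ltW T_gt0) // le_min !mulr_ge0 // subr_ge0.
Qed.

Lemma green_le t s : 0 <= t <= T -> 0 <= s <= T -> green t s <= T.
Proof.
move=> /andP[t0 tT] /andP[s0 sT]; rewrite ler_pdivrMr //.
apply: (@le_trans _ _ (t * (T - s))); first by rewrite ge_min lexx.
by rewrite ler_pM // ?subr_ge0 // lerBlDr lerDl.
Qed.

Lemma green0 s : 0 <= s <= T -> green 0 s = 0.
Proof.
move=> /andP[s0 sT]; rewrite /green mul0r subr0 min_l ?mul0r //.
by rewrite mulr_ge0 // ltW.
Qed.

Lemma greenT s : 0 <= s <= T -> green T s = 0.
Proof.
move=> /andP[s0 sT]; rewrite /green subrr mulr0 min_r ?mul0r //.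
by rewrite mulr_ge0 // ?subr_ge0 // ltW.
Qed.

Lemma greenC t s : green t s = green s t.
Proof. by rewrite /green minC. Qed.

Lemma greenE t s : t <= s -> green t s = t * (T - s) / T.
Proof.
by move=> ts; rewrite /green min_l // mulrBr mulrBr (mulrC s t) lerD2r ler_pM2r.
Qed.

Lemma green_lipschitz t t' s : 0 <= s <= T ->
  `|green t s - green t' s| <= `|t - t'|.
Proof.
move=> /andP[s0 sT]; rewrite -mulrBl normrM [`|T^-1|]gtr0_norm ?invr_gt0 //.
rewrite ler_pdivrMr //; apply: minr_dist.
  rewrite -mulrBl normrM ler_wpM2l // ger0_norm ?subr_ge0 // lerBlDr lerDl //.
have -> : s * (T - t) - s * (T - t') = (t' - t) * s by ring.
rewrite normrM distrC.
by rewrite ler_wpM2l // ger0_norm.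
Qed.

Lemma green_concave s : concave_on T (green^~ s).
Proof.
move=> x y z x0 xy yz zT; rewrite /green !mulrA -mulrDl ler_pM2r ?invr_gt0 //.
have zx : 0 <= z - x by lra.
rewrite [leRHS]minr_pMr // le_min; apply/andP; split.
  apply: (@le_trans _ _ ((z - y) * (x * (T - s)) + (y - x) * (z * (T - s)))); last by lra.
  by rewrite lerD // ler_wpM2l ?subr_ge0 // ge_min lexx.
apply: (@le_trans _ _ ((z - y) * (s * (T - x)) + (y - x) * (s * (T - z)))); last by lra.
by rewrite lerD // ler_wpM2l ?subr_ge0 // ge_min lexx orbT.
Qed.

Lemma green_continuous s : continuous (green^~ s).
Proof.
move=> t; apply: cvgMr_tmp; have := @continuous_min R R (fun t => t * (T - s)) (fun t => s * (T - t)) t.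
apply.
  by apply: cvgMr_tmp; exact: cvg_id.
by apply: cvgMl_tmp; apply: cvgB; [exact: cvg_cst|exact: cvg_id].
Qed.

End Green.

(** * The kernel of the boundary value problem *)

Section Kernel.
Variables (R : realType) (T eta alpha beta : R).
Hypothesis eta_gt0 : 0 < eta.
Hypothesis eta_ltT : eta < T.
Hypothesis alpha_gt0 : 0 < alpha.
Hypothesis beta_ge0 : 0 <= beta.

Let T_gt0 : 0 < T. Proof. exact: lt_trans eta_ltT. Qed.

Definition bvp_kappa := 2 * T - alpha * eta ^+ 2.
Definition bvp_det :=
  (2 * T - alpha * eta ^+ 2) - beta * (alpha * eta ^+ 2 - 2 * eta + 2 * T).
Local Notation kappa := bvp_kappa.
Local Notation det := bvp_det.

Hypothesis kappa_gt0 : 0 < kappa.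
Hypothesis det_gt0 : 0 < det.

(* If u = p (1 - t/T) + q t/T + h with h 0 = h T = 0, the boundary conditions
   are a linear system in p and q, whose solution gives u eta and u T in terms
   of a := h eta and H := \int_0^eta h. *)
Definition mid_value (a H : R) := (2 * alpha * eta * H + kappa * a) / det.
Definition end_value (a H : R) :=
  alpha * (beta * mid_value a H * eta * (2 * T - eta) + 2 * T * H) / kappa.

Lemma mid_valueE a H : beta * mid_value a H * (1 - eta / T) +
  end_value a H * (eta / T) + a = mid_value a H.
Proof.
rewrite /end_value /mid_value /kappa /det; field.
by rewrite !gt_eqF.
Qed.

Lemma end_valueE a H : end_value a H =
  alpha * (beta * mid_value a H * (eta - eta ^+ 2 / (2 * T)) +
           end_value a H * (eta ^+ 2 / (2 * T)) + H).
Proof.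
rewrite /end_value; set m := mid_value a H; rewrite /kappa; field.
by rewrite !gt_eqF.
Qed.

(** The upper bounds on alpha and beta act here, as positivity of kappa and det. Monotonicity gives
    both the sign and the upper bounds of the kernel. *)
Lemma le_mid_value a H a' H' : a <= a' -> H <= H' -> mid_value a H <= mid_value a' H'.
Proof.
move=> aa HH; rewrite ler_pM2r ?invr_gt0 // lerD // ler_pM2l //.
by rewrite !mulr_gt0.
Qed.

Lemma le_end_value a H a' H' : a <= a' -> H <= H' -> end_value a H <= end_value a' H'.
Proof.
move=> aa HH; rewrite ler_pM2r ?invr_gt0 // ler_pM2l //.
rewrite lerD // ?ler_pM2l ?mulr_gt0 //.
rewrite ler_pM2r ?subr_gt0; last by rewrite (lt_trans eta_ltT) // ltr_pMl // ltr1n.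
by rewrite ler_pM2r // ler_wpM2l // le_mid_value.
Qed.

Lemma mid_value0 : mid_value 0 0 = 0. Proof. by rewrite /mid_value !mulr0 addr0 mul0r. Qed.
Lemma end_value0 : end_value 0 0 = 0.
Proof. by rewrite /end_value mid_value0 !(mulr0, mul0r, addr0). Qed.

(** The terms in alpha cancel: 2 alpha eta H is at least alpha eta^2 a, which is what kappa a lacks
    to 2 T a. *)
Lemma mid_value_ge a H : eta * a / 2 <= H -> 2 * T * a / det <= mid_value a H.
Proof.
move=> h; rewrite ler_pM2r ?invr_gt0 //.
have : 2 * alpha * eta * (eta * a / 2) <= 2 * alpha * eta * H.
  by rewrite ler_pM2l // !mulr_gt0.
rewrite /kappa; lra.
Qed.

(** The datum H of the linear system when h is the section of the Green function at s. *)
Definition green_mass s := seg_int 0 eta ((green T)^~ s).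

Lemma green_mass_ge0 s : 0 <= s <= T -> 0 <= green_mass s.
Proof.
move=> sT; apply: Rintegral_ge0 => t /=; rewrite in_itv /= => /andP[t0 te].
by apply: green_ge0 => //; rewrite t0 (le_trans te) // ltW.
Qed.

Lemma green_mass_le s : 0 <= s <= T -> green_mass s <= T * eta.
Proof.
move=> sT; rewrite -[X in _ * X]subr0 -(seg_int_cst _ (ltW eta_gt0)).
apply: le_seg_int; [exact: green_continuous|exact: cst_continuous|].
move=> t /andP[t0 te].
by apply: green_le => //; rewrite t0 (le_trans te) // ltW.
Qed.

Lemma green_mass_lower s : 0 <= s <= T -> eta * green T eta s / 2 <= green_mass s.
Proof.
move=> sT; have := @concave_seg_int R T eta ((green T)^~ s).
rewrite green0 // add0r; apply; last exact: (green_concave T_gt0).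
  by rewrite !ltW.
exact: green_continuous.
Qed.

Lemma green_mass_continuous : continuous (fun s => green_mass s).
Proof.
move=> s; apply/cvgrPdist_le => e e0.
have d0 : 0 < e / eta by rewrite divr_gt0.
have := @cvg_id _ (nbhs s) => /cvgrPdist_le/(_ _ d0); apply: filterS => s' hs.
have -> : green_mass s - green_mass s' =
    seg_int 0 eta (fun t => green T t s + -1 * green T t s') - 0 * (eta - 0).
  rewrite (@seg_intD _ ((green T)^~ s) (fun t => -1 * green T t s')); first last.
  - by move=> t; apply: cvgMl_tmp; exact: green_continuous.
  - exact: green_continuous.
  rewrite (@seg_intZ _ ((green T)^~ s')); last exact: green_continuous.
  by rewrite /green_mass; lra.
have -> : e = e / eta * (eta - 0) by rewrite subr0 mulfVK // gt_eqF.
apply: seg_int_le_dist; [|exact: ltW|].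
  move=> t; apply: cvgD; first exact: green_continuous.
  by apply: cvgMl_tmp; exact: green_continuous.
move=> t /andP[t0 te]; rewrite mulN1r subr0 !(greenC _ t).
by apply: le_trans hs; apply: green_lipschitz => //; rewrite t0 (le_trans te) // ltW.
Qed.

Definition mid s := mid_value (green T eta s) (green_mass s).
Definition endv s := end_value (green T eta s) (green_mass s).

(** The response to a unit point load at s: the Green function plus the affine function whose end
    values, [beta * mid s] at 0 and [endv s] at T, are dictated by the boundary conditions. *)
Definition bvp_kernel t s :=
  beta * mid s * (1 - t / T) + endv s * (t / T) + green T t s.

Let etaT : 0 <= eta <= T. Proof. by rewrite !ltW. Qed.

Lemma mid_ge0 s : 0 <= s <= T -> 0 <= mid s.
Proof.
by move=> sT; rewrite -mid_value0 le_mid_value // ?green_ge0 // green_mass_ge0.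
Qed.

Lemma endv_ge0 s : 0 <= s <= T -> 0 <= endv s.
Proof.
by move=> sT; rewrite -end_value0 le_end_value // ?green_ge0 // green_mass_ge0.
Qed.

Lemma bvp_kernel_eta s : bvp_kernel eta s = mid s.
Proof. exact: mid_valueE. Qed.

Lemma bvp_kernel0 s : 0 <= s <= T -> bvp_kernel 0 s = beta * bvp_kernel eta s.
Proof.
by move=> sT; rewrite bvp_kernel_eta /bvp_kernel green0 // mul0r subr0 mulr1 mulr0 !addr0.
Qed.

Lemma bvp_kernel_continuous s : continuous (bvp_kernel^~ s).
Proof.
move=> t; apply: cvgD; last exact: green_continuous.
apply: cvgD; apply: cvgMl_tmp; last by apply: cvgMr_tmp; exact: cvg_id.
by apply: cvgB; [exact: cvg_cst|apply: cvgMr_tmp; exact: cvg_id].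
Qed.

Lemma bvp_kernelT s : 0 <= s <= T ->
  bvp_kernel T s = alpha * seg_int 0 eta (bvp_kernel^~ s).
Proof.
move=> sT; have -> : bvp_kernel T s = endv s.
  by rewrite /bvp_kernel greenT // divff ?gt_eqF // subrr mulr0 mulr1 add0r addr0.
rewrite {1}/endv end_valueE; congr (_ * _).
have -> : seg_int 0 eta (bvp_kernel^~ s) = seg_int 0 eta
    (fun t => (beta * mid s + (endv s - beta * mid s) / T * t) + green T t s).
  by apply: eq_seg_int => t _; rewrite /bvp_kernel; field; rewrite gt_eqF.
rewrite (@seg_intD _ (fun t => beta * mid s + (endv s - beta * mid s) / T * t)); first last.
- exact: green_continuous.
- by move=> t; apply: cvgD; [exact: cvg_cst|apply: cvgMl_tmp; exact: cvg_id].
rewrite seg_int_affine ?ltW // -/(green_mass s) -/(mid s) -/(endv s).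
by field; rewrite gt_eqF.
Qed.

Lemma bvp_kernel_concave s : concave_on T (bvp_kernel^~ s).
Proof.
move=> x y z x0 xy yz zT; have := @green_concave R T T_gt0 s x y z x0 xy yz zT.
rewrite /bvp_kernel; set p := beta * mid s; set q := endv s.
have : (z - y) * (p * (1 - x / T) + q * (x / T)) +
  (y - x) * (p * (1 - z / T) + q * (z / T)) =
  (z - x) * (p * (1 - y / T) + q * (y / T)) by ring.
lra.
Qed.

Lemma bvp_kernel_ge0 t s : 0 <= t <= T -> 0 <= s <= T -> 0 <= bvp_kernel t s.
Proof.
move=> tT sT; have /andP[t0 t1] := tT.
have tT0 : 0 <= t / T by rewrite divr_ge0 // ltW.
have tT1 : t / T <= 1 by rewrite ler_pdivrMr // mul1r.
rewrite /bvp_kernel addr_ge0 ?green_ge0 // addr_ge0 // mulr_ge0 ?endv_ge0 //.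
  by rewrite mulr_ge0 ?mid_ge0.
by rewrite subr_ge0.
Qed.

(** For s >= eta the Green function at eta is eta (T - s) / T, and [mid_value_ge] multiplies it by 2
    T / det. This is the origin of the weight T - s and of the constants in [bvp_Lambda2]. *)
Lemma bvp_kernel_lower s : eta <= s <= T ->
  2 * eta * (T - s) / det <= bvp_kernel eta s.
Proof.
move=> /andP[es sT]; rewrite bvp_kernel_eta.
have s0T : 0 <= s <= T by rewrite sT (le_trans (ltW eta_gt0)).
apply: le_trans (mid_value_ge (green_mass_lower s0T)).
by rewrite greenE // ler_pM2r ?invr_gt0 // le_eqVlt; apply/orP; left; apply/eqP; field; rewrite gt_eqF.
Qed.

Lemma bvp_kernel_bounded : exists2 L, 0 < L & forall s, 0 <= s <= T ->
  (forall t, 0 <= t <= T -> bvp_kernel t s <= L) /\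
  (forall t t', `|bvp_kernel t s - bvp_kernel t' s| <= L * `|t - t'|).
Proof.
pose m := mid_value T (T * eta); pose q := end_value T (T * eta).
have m0 : 0 <= m by rewrite /m -mid_value0 le_mid_value ?mulr_ge0 // ltW.
have q0 : 0 <= q by rewrite /q -end_value0 le_end_value ?mulr_ge0 // ltW.
have bm0 : 0 <= beta * m by rewrite mulr_ge0.
have c0 : 0 <= (q + beta * m) / T by rewrite divr_ge0 ?addr_ge0 // ltW.
(* One constant for two purposes: beta m + q + T bounds the kernel, and (q + beta m) / T + 1 bounds
   its slope in t, the 1 being the Lipschitz constant of the Green function. *)
exists (beta * m + q + T + (q + beta * m) / T + 1); first by have := T_gt0; lra.
move=> s sT.
have ms : mid s <= m by rewrite le_mid_value ?green_le ?green_mass_le.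
have qs : endv s <= q by rewrite le_end_value ?green_le ?green_mass_le.
have bms : beta * mid s <= beta * m by rewrite ler_wpM2l.
have bms0 : 0 <= beta * mid s by rewrite mulr_ge0 // mid_ge0.
have qs0 := endv_ge0 sT.
split=> [t tT|t t'].
  have := green_le T_gt0 tT sT; have /andP[t0 t1] := tT.
  have tt0 : 0 <= t / T by rewrite divr_ge0 // ltW.
  have tt1 : t / T <= 1 by rewrite ler_pdivrMr // mul1r.
  have : beta * mid s * (1 - t / T) <= beta * m.
    by rewrite -[leRHS]mulr1; apply: ler_pM => //; lra.
  have : endv s * (t / T) <= q by rewrite -[leRHS]mulr1 ler_pM.
  rewrite /bvp_kernel; lra.
have -> : bvp_kernel t s - bvp_kernel t' s =
    (endv s - beta * mid s) / T * (t - t') + (green T t s - green T t' s).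
  by rewrite /bvp_kernel; ring.
apply: le_trans (ler_normD _ _) _; have := green_lipschitz T_gt0 t t' sT.
rewrite normrM => h.
have h2 : `|(endv s - beta * mid s) / T| <= (q + beta * m) / T.
  rewrite normrM [`|T^-1|]gtr0_norm ?invr_gt0 // ler_pM2r ?invr_gt0 // ler_norml.
  apply/andP; split; lra.
have h3 : `|(endv s - beta * mid s) / T| * `|t - t'| <= (q + beta * m) / T * `|t - t'|.
  by rewrite ler_wpM2r.
have h4 : 0 <= (beta * m + q + T) * `|t - t'|.
  by rewrite mulr_ge0 // !addr_ge0 // ltW.
lra.
Qed.

Lemma bvp_kernel_continuous_r t : continuous (bvp_kernel t).
Proof.
have cg t' : continuous (green T t').
  by move=> s; rewrite (_ : green T t' = (green T)^~ t'); [exact: green_continuous|apply/funext => x; rewrite greenC].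
have cm : continuous mid.
  move=> s; apply: cvgMr_tmp; apply: cvgD; apply: cvgMl_tmp.
    exact: green_mass_continuous.
  exact: cg.
move=> s; apply: cvgD; last exact: cg.
apply: cvgD; apply: cvgMr_tmp; first by apply: cvgMl_tmp; exact: cm.
apply: cvgMr_tmp; apply: cvgMl_tmp; apply: cvgD.
  by do 2 apply: cvgMr_tmp; apply: cvgMl_tmp; exact: cm.
by apply: cvgMl_tmp; exact: green_mass_continuous.
Qed.

End Kernel.

(** * Existence for sublinear integral equations *)

Section IntegralFixpoint.
Variables (R : realType) (T eta alpha L eps B : R).
Variables (k : R -> R -> R) (Fn : R -> R -> R -> R).
Hypothesis eta_ge0 : 0 <= eta.
Hypothesis eta_leT : eta <= T.
Hypothesis T_gt0 : 0 < T.
Hypothesis L_gt0 : 0 < L.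
Hypothesis k_ge0 : forall t s, 0 <= t <= T -> 0 <= s <= T -> 0 <= k t s.
Hypothesis k_le : forall t s, 0 <= t <= T -> 0 <= s <= T -> k t s <= L.
Hypothesis k_lip : forall t t' s, 0 <= s <= T -> `|k t s - k t' s| <= L * `|t - t'|.
Hypothesis k_cont_l : forall s, continuous (k^~ s).
Hypothesis k_cont_r : forall t, continuous (k t).
Hypothesis k_end : forall s, 0 <= s <= T -> k T s = alpha * seg_int 0 eta (k^~ s).
Hypothesis eps_ge0 : 0 <= eps.
Hypothesis eps_lt : eps * (T * L) < 1.
Hypothesis B_ge0 : 0 <= B.
Hypothesis Fn_ge0 : forall s v n, 0 <= s <= T -> 0 <= v -> v <= n -> 0 <= Fn s v n.
Hypothesis Fn_le : forall s v n, 0 <= s <= T -> 0 <= v -> v <= n ->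
  Fn s v n <= eps * n + B.
Hypothesis Fn_cont : forall (I : Type) (F : set_system I) (s v n : I -> R) s0 v0 n0,
  Filter F -> s i @[i --> F] --> s0 -> v i @[i --> F] --> v0 ->
  n i @[i --> F] --> n0 -> Fn (s i) (v i) (n i) @[i --> F] --> Fn s0 v0 n0.

(** Chosen so that one step of the discretized equation, whose total mass is at most T (eps L M +
    B), stays below M. The summand 1 keeps M positive when B is 0. *)
Let M := T * B / (1 - eps * (T * L)) + 1.

Let M_gt0 : 0 < M.
Proof. by rewrite ltr_wpDl // divr_ge0 ?mulr_ge0 ?subr_ge0 // ltW. Qed.

Let M_bound : T * (eps * (L * M) + B) <= M.
Proof.
have h : 0 < 1 - eps * (T * L) by rewrite subr_gt0.
have -> : T * (eps * (L * M) + B) =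
    M - (1 - eps * (T * L)); last by rewrite gerBl ltW.
by rewrite /M; field; rewrite gt_eqF.
Qed.

Let LM_ge0 : 0 <= L * M. Proof. by rewrite mulr_ge0 // ltW. Qed.

Section Discretization.
Variable m : nat.
Let d := T / m.+1%:R.
Let node (j : 'I_m.+1) := d * j.+1%:R.

Let d_gt0 : 0 < d. Proof. by rewrite divr_gt0 // ltr0n. Qed.
Let dT : d * m.+1%:R = T. Proof. by rewrite mulfVK // pnatr_eq0. Qed.

Let node_itv j : 0 <= node j <= T.
Proof.
rewrite mulr_ge0 ?(ltW d_gt0) //= /node -[leRHS]dT ler_pM2l // ler_nat.
exact: ltn_ord.
Qed.

Let corner (x : 'I_m.+1 -> R) := (forall j, 0 <= x j) /\ \sum_j x j <= M.
(** The unknowns are the weights of the kernel sections rather than the values of u. Every candidate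
    then has bound and Lipschitz constant L M, whatever the mesh. *)
Let comb (x : 'I_m.+1 -> R) t := \sum_j x j * k t (node j).

Let comb_continuous x : continuous (comb x).
Proof.
move=> t; apply: (@cvg_big R 'I_m.+1 +%R 0 predT _ R (nbhs t) (index_enum _)
  (fun j t => x j * k t (node j))); first exact: add_continuous.
by move=> j _; apply: cvgMl_tmp; exact: k_cont_l.
Qed.

Let comb_ge0 x t : corner x -> 0 <= t <= T -> 0 <= comb x t.
Proof. by move=> [x0 _] tT; apply: sumr_ge0 => j _; rewrite mulr_ge0 ?k_ge0. Qed.

Let comb_le x t : corner x -> 0 <= t <= T -> comb x t <= L * M.
Proof.
move=> [x0 xM] tT; apply: (@le_trans _ _ (\sum_j x j * L)).
  by apply: ler_sum => j _; rewrite ler_wpM2l ?k_le.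
by rewrite -mulr_suml mulrC ler_pM2l.
Qed.

Let comb_norm x : corner x -> sup_norm T (comb x) <= L * M.
Proof.
move=> cx; apply: sup_norm_le => [|t tT]; first exact: ltW.
by rewrite ger0_norm ?comb_ge0 ?comb_le.
Qed.

Let comb_le_norm x t : corner x -> 0 <= t <= T -> comb x t <= sup_norm T (comb x).
Proof.
move=> cx tT; apply: le_trans (ler_norm _) _.
by apply: sup_norm_ge => //; exact: ltW.
Qed.

Let comb_lip x t t' : corner x -> `|comb x t - comb x t'| <= L * M * `|t - t'|.
Proof.
move=> [x0 xM]; rewrite -sumrB; apply: le_trans (ler_norm_sum _ _ _) _.
apply: (@le_trans _ _ (\sum_j x j * (L * `|t - t'|))).
  apply: ler_sum => j _; rewrite -mulrBr normrM ger0_norm //.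
  by rewrite ler_wpM2l ?k_lip.
by rewrite -mulr_suml mulrA ler_wpM2r // mulrC ler_pM2l.
Qed.

(** The integral condition is verified on finite combinations, where it follows by linearity, and is
    later passed to the limit. This avoids exchanging two integrals. *)
Let comb_end x : comb x T = alpha * seg_int 0 eta (comb x).
Proof.
suff -> : seg_int 0 eta (comb x) = \sum_j x j * seg_int 0 eta (k^~ (node j)).
  rewrite mulr_sumr; apply: eq_bigr => j _; rewrite k_end //; ring.
rewrite /comb; elim: (index_enum _) => [|j r IH].
  rewrite big_nil -[RHS](mul0r (eta - 0)) -(seg_int_cst _ eta_ge0).
  by apply: eq_seg_int => t _; rewrite big_nil.
rewrite big_cons -IH -seg_intZ //.
rewrite -(@seg_intD _ (fun t => x j * k t (node j))).
- by apply: eq_seg_int => t _; rewrite big_cons.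
- by move=> t; apply: cvgMl_tmp; exact: k_cont_l.
move=> t; apply: (@cvg_big R 'I_m.+1 +%R 0 predT _ R (nbhs t) r
  (fun j t => x j * k t (node j))); first exact: add_continuous.
by move=> i _; apply: cvgMl_tmp; exact: k_cont_l.
Qed.

Let step x (j : 'I_m.+1) :=
  d * Fn (node j) (comb x (node j)) (sup_norm T (comb x)).

Let step_corner x : corner x -> corner (step x).
Proof.
move=> cx; split=> [j|].
  by rewrite mulr_ge0 ?(ltW d_gt0) // Fn_ge0 ?comb_ge0 ?comb_le_norm.
apply: le_trans M_bound; rewrite -[X in _ <= X * _]dT -mulrA -mulr_sumr ler_pM2l //.
rewrite mulr_natl -[X in _ *+ X]card_ord -sumr_const.
apply: ler_sum => j _.
apply: (le_trans (Fn_le (node_itv j) (comb_ge0 cx (node_itv j))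
  (comb_le_norm cx (node_itv j)))).
by rewrite lerD2r ler_wpM2l // comb_norm.
Qed.

Let step_continuous (F : set_system nat) (u : nat -> 'I_m.+1 -> R) x :
  ProperFilter F -> (forall k, corner (u k)) -> corner x ->
  (forall j, u k j @[k --> F] --> x j) ->
  forall j, step (u k) j @[k --> F] --> step x j.
Proof.
move=> FF _ _ ux j; apply: cvgMl_tmp; apply: Fn_cont; first exact: cvg_cst.
  by apply: cvg_sum_fin => i; apply: cvgMr_tmp; exact: ux.
have h : (\sum_j (L * `|x j - u i j|)) @[i --> F] --> \sum_(j < m.+1) (L * 0).
  apply: (@cvg_sum_fin _ _ F _ (fun i j => L * `|x j - u i j|) (fun=> L * 0)) => i.
  apply: cvgMl_tmp; rewrite -(normr0 R); apply: cvg_norm.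
  by rewrite -(subrr (x i)); apply: cvgB; [exact: cvg_cst|exact: ux].
apply/cvgrPdist_le => e e0.
have := h; rewrite big1 => [|i _]; last by rewrite mulr0.
move=> /cvgrPdist_le/(_ _ e0); apply: filterS => i; rewrite sub0r normrN => hi.
apply: sup_norm_dist; rewrite ?(ltW T_gt0) //; try exact: comb_continuous.
move=> t tT; apply: le_trans hi; apply: le_trans (ler_norm _).
rewrite /comb -sumrB; apply: le_trans (ler_norm_sum _ _ _) _.
apply: ler_sum => l _; rewrite -mulrBl normrM mulrC ler_wpM2r //.
by rewrite ger0_norm ?k_ge0 ?k_le.
Qed.

Lemma discrete_fixpoint : exists U : R -> R,
  [/\ continuous U, (forall t, 0 <= t <= T -> 0 <= U t <= L * M),
      (forall t t', `|U t - U t'| <= L * M * `|t - t'|),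
      U T = alpha * seg_int 0 eta U &
      forall t, U t = \sum_(j < m.+1) T / m.+1%:R *
        (Fn (T / m.+1%:R * j.+1%:R) (U (T / m.+1%:R * j.+1%:R)) (sup_norm T U) *
         k t (T / m.+1%:R * j.+1%:R))].
Proof.
have [|x cx fx] := @brouwer_corner R 'I_m.+1 M step _ M_gt0 step_corner step_continuous.
  by rewrite card_ord.
exists (comb x); split=> //.
- by move=> t tT; rewrite (comb_ge0 cx tT) (comb_le cx tT).
- by move=> t t'; exact: comb_lip.
- by move=> t; apply: eq_bigr => j _; rewrite -{1}(fx j) [RHS]mulrA.
Qed.

End Discretization.

(** Ultralimits are taken pointwise. The common Lipschitz constant upgrades them to convergence
    along moving points and hence to uniform convergence, under which the norm, the integral
    condition and the Riemann sums all pass to the limit. *)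
Theorem integral_fixpoint : exists u : R -> R,
  [/\ continuous u, (forall t, 0 <= t <= T -> 0 <= u t),
      u T = alpha * seg_int 0 eta u,
      continuous (fun s => Fn s (u s) (sup_norm T u)) &
      forall t, u t = seg_int 0 T (fun s => Fn s (u s) (sup_norm T u) * k t s)].
Proof.
have [U hU] := choice discrete_fixpoint.
have [F [FU Foo]] := @ultraFilterLemma _ (nbhs \oo) _.
have FF := @ultra_proper _ F FU.
have T0 := ltW T_gt0.
have TT : 0 <= (0 : R) <= T by rewrite lexx.
have Ucont i : continuous (U i) by have [] := hU i.
have Ulip i t t' : `|U i t - U i t'| <= L * M * `|t - t'| by have [_ _ +] := hU i.
have Upt t : exists l : R, U i t @[i --> F] --> l.
  (* Outside [0, T] only the Lipschitz estimate from the point 0 is available, so the bound depends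
     on t. *)
  apply: (@ultra_bounded_cvg _ _ _ (- (L * M + L * M * `|t - 0|)) (L * M + L * M * `|t - 0|)) => //.
  apply: nearW => i; rewrite -ler_norml -[U i t](subrK (U i 0)).
  apply: le_trans (ler_normD _ _) _; rewrite addrC lerD ?Ulip //.
  have [_ /(_ 0 TT)/andP[h1 h2] _ _ _] := hU i.
  by rewrite ger0_norm.
have [u hu] := choice Upt.
have ulip t t' : `|u t - u t'| <= L * M * `|t - t'|.
  have h : `|U i t - U i t'| @[i --> F] --> `|u t - u t'|.
    by apply: cvg_norm; apply: cvgB; exact: hu.
  by apply: (cvgr_to_le h); apply: nearW => i; exact: Ulip.
have ucont : continuous u.
  move=> t; apply/cvgrPdist_le => e e0.
  have d0 : 0 < e / (L * M) by rewrite divr_gt0 // mulr_gt0.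
  have := @cvg_id _ (nbhs t) => /cvgrPdist_le/(_ _ d0); apply: filterS => s.
  rewrite ler_pdivlMr ?mulr_gt0 // => hs; apply: le_trans (ulip _ _) _.
  by rewrite mulrC.
have Umove : moving_cvg T F U u.
  move=> s s0 _ _ ss0.
  have h : L * M * `|s i - s0| @[i --> F] --> 0.
    rewrite -[X in _ --> X](mulr0 (L * M)); apply: cvgMl_tmp.
    rewrite -(normr0 R) -(subrr s0); apply: cvg_norm.
    by apply: cvgB; [exact: ss0|exact: cvg_cst].
  rewrite (_ : (fun i => U i (s i)) = (fun i => U i s0 + (U i (s i) - U i s0))); last first.
    by apply/funext => i; rewrite addrC subrK.
  rewrite -[X in _ --> X]addr0; apply: cvgD; first exact: hu.
  apply/norm_cvg0P; apply: (squeeze_cvgr _ (cvg_cst 0) h).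
  by apply: nearW => i; rewrite normr_ge0 Ulip.
have unif e : 0 < e -> \forall i \near F, forall t, 0 <= t <= T -> `|U i t - u t| <= e.
  move=> e0; have := moving_cvg_uniform T_gt0 FU Foo ucont Umove e0.
  apply: filterS => i hi t tT; apply/ltW/hi => //.
  by rewrite subrr normr0 divr_ge0.
have Ncvg : sup_norm T (U i) @[i --> F] --> sup_norm T u.
  apply/cvgrPdist_le => e /unif; apply: filterS => i hi; rewrite distrC.
  by apply: sup_norm_dist; rewrite ?ltW //; exact: Ucont.
have yc : continuous (fun s => Fn s (u s) (sup_norm T u)).
  move=> s; apply: Fn_cont; [exact: cvg_id|exact: ucont|exact: cvg_cst].
exists u; split=> //.
- move=> t tT; apply: (cvgr_to_ge (hu t)); apply: nearW => i.
  by have [_ /(_ t tT)/andP[]] := hU i.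
- apply: cvg_unique (hu T) _ => //.
  have h : alpha * seg_int 0 eta (U i) @[i --> F] --> alpha * seg_int 0 eta u.
    apply: cvgMl_tmp; apply/cvgrPdist_le => e e0.
    have d0 : 0 < e / T by rewrite divr_gt0.
    have := unif _ d0; apply: filterS => i hi.
    have -> : seg_int 0 eta u - seg_int 0 eta (U i) =
        seg_int 0 eta (fun t => u t + -1 * U i t) - 0 * (eta - 0).
      rewrite seg_intD //; last by move=> x; apply: cvgMl_tmp; exact: Ucont.
      by rewrite seg_intZ //; lra.
    apply: (@le_trans _ _ (e / T * (eta - 0))).
      apply: seg_int_le_dist => //.
        move=> t; apply: cvgD; first exact: ucont.
        by apply: cvgMl_tmp; exact: Ucont.
      move=> t /andP[t0 te]; rewrite mulN1r subr0 distrC.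
      by apply: hi; rewrite t0 (le_trans te).
    by rewrite subr0 -mulrA ger_pMr // mulrC ler_pdivrMr // mul1r.
  have -> // : (fun i => U i T) = (fun i => alpha * seg_int 0 eta (U i)).
  by apply/funext => i; have [_ _ _ ->] := hU i.
move=> t; apply: cvg_unique (hu t) _ => //.
have -> : (fun i => U i t) = (fun i => \sum_(j < i.+1) T / i.+1%:R *
    (fun i s => Fn s (U i s) (sup_norm T (U i)) * k t s) i (T / i.+1%:R * j.+1%:R)).
  by apply/funext => i; have [_ _ _ _ ->] := hU i.
apply: (@riemann_sum_cvg R T F T_gt0 FU Foo
  (fun i s => Fn s (U i s) (sup_norm T (U i)) * k t s)
  (fun s => Fn s (u s) (sup_norm T u) * k t s)).
  by move=> s; apply: cvgM; [exact: yc|exact: k_cont_r].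
move=> s s0 sT s0T ss0; apply: cvgM; last first.
  by apply: continuous_cvg ss0; exact: k_cont_r.
by apply: Fn_cont => //; exact: Umove.
Qed.

End IntegralFixpoint.

(** * From the integral equation to the differential equation *)

Section KernelSolution.
Variables (R : realType) (T eta alpha beta : R).
Hypothesis eta_gt0 : 0 < eta.
Hypothesis eta_ltT : eta < T.
Hypothesis alpha_gt0 : 0 < alpha.
Hypothesis beta_ge0 : 0 <= beta.
Hypothesis kappa_gt0 : 0 < bvp_kappa T eta alpha.
Hypothesis det_gt0 : 0 < bvp_det T eta alpha beta.
Local Notation kernel := (bvp_kernel T eta alpha beta).

Variables (y u : R -> R).
Hypothesis y_cont : continuous y.
Hypothesis uE : forall t, u t = seg_int 0 T (fun s => y s * kernel t s).

Let T_gt0 : 0 < T. Proof. exact: lt_trans eta_ltT. Qed.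
Let kernel_cont t : continuous (kernel t).
Proof. exact: bvp_kernel_continuous_r. Qed.

(** Splitting the Green integral at s = t leaves integrands free of t, so that t enters only through
    coefficients and upper limits and the fundamental theorem of calculus applies. *)
Let left_moment t := seg_int 0 t (fun s => s * y s).
Let right_moment t := seg_int 0 t (fun s => (T - s) * y s).

Let cont_id_y : continuous (fun s : R => s * y s).
Proof. by move=> s; apply: cvgM; [exact: cvg_id|exact: y_cont]. Qed.

Let cont_sub_y : continuous (fun s : R => (T - s) * y s).
Proof.
move=> s; apply: cvgM; last exact: y_cont.
by apply: cvgB; [exact: cvg_cst|exact: cvg_id].
Qed.

Let cont_y_kernel t : continuous (fun s => y s * kernel t s).
Proof. by move=> s; apply: cvgM; [exact: y_cont|exact: kernel_cont]. Qed.

Let cont_y_green t : continuous (fun s => y s * green T t s).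
Proof.
move=> s; apply: cvgM; first exact: y_cont.
rewrite (_ : green T t = (green T)^~ t); first exact: green_continuous.
by apply/funext => x; rewrite greenC.
Qed.

Let green_integral t : 0 <= t <= T -> seg_int 0 T (fun s => y s * green T t s) =
  ((T - t) * left_moment t + t * (right_moment T - right_moment t)) / T.
Proof.
move=> /andP[t0 tT].
rewrite (seg_int_cat (@cont_y_green t) t0 tT) /right_moment (seg_int_cat cont_sub_y t0 tT).
have -> : seg_int 0 t (fun s => y s * green T t s) =
    seg_int 0 t (fun s => (T - t) / T * (s * y s)).
  by apply: eq_seg_int => s /andP[_ st]; rewrite greenC greenE //; ring.
have -> : seg_int t T (fun s => y s * green T t s) =
    seg_int t T (fun s => t / T * ((T - s) * y s)).
  by apply: eq_seg_int => s /andP[st _]; rewrite greenE //; ring.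
rewrite !seg_intZ // -/(left_moment t); ring.
Qed.

(** The affine part of the kernel interpolates its values at 0 and T; after integration it
    interpolates those of u. *)
Let solutionE t : 0 <= t <= T -> u t = u 0 * (1 - t / T) + u T * (t / T) +
  ((T - t) * left_moment t + t * (right_moment T - right_moment t)) / T.
Proof.
move=> tT; rewrite -(green_integral tT) !uE.
have -> : seg_int 0 T (fun s => y s * kernel t s) = seg_int 0 T (fun s =>
    ((1 - t / T) * (y s * kernel 0 s) + t / T * (y s * kernel T s)) + y s * green T t s).
  apply: eq_seg_int => s sT; rewrite /bvp_kernel (green0 _ sT) ?(greenT _ sT) //.
  by field; rewrite gt_eqF.
rewrite seg_intD //; last first.
  by move=> s; apply: cvgD; apply: cvgMl_tmp; exact: cont_y_kernel.
rewrite seg_intD; [|by move=> s; apply: cvgMl_tmp; exact: cont_y_kernel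
  |by move=> s; apply: cvgMl_tmp; exact: cont_y_kernel].
by rewrite !seg_intZ //; ring.
Qed.

(** The terms t (T - t) y(t) coming from the two moments cancel in the derivative. *)
Let slope t := (u T - u 0) / T + (right_moment T - right_moment t - left_moment t) / T.

Let near_itv t : 0 < t < T -> \forall s \near t, 0 < s < T.
Proof.
move=> tT; have := @near_in_itvoo R 0 T t; rewrite in_itv => /(_ tT).
by apply: filterS => s; rewrite in_itv.
Qed.

Let is_derive_solution t : 0 < t < T -> is_derive t 1 u (slope t).
Proof.
move=> tT; have /andP[t0 t1] := tT.
apply: (@near_eq_is_derive R R^o R^o (fun t : R => u 0 * (1 - t * T^-1) + u T * (t * T^-1) +
  ((T - t) * left_moment t + t * (right_moment T - right_moment t)) * T^-1)).
  near=> s; apply/esym/solutionE; have : 0 < s < T by near: s; exact: near_itv.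
  by move=> /andP[/ltW -> /ltW ->].
have d1 : is_derive t 1 left_moment (t * y t) by exact: is_derive_seg_int.
have d2 : is_derive t 1 right_moment ((T - t) * y t) by exact: is_derive_seg_int.
apply: is_derive_eq; rewrite /GRing.scale /= /slope; ring.
Unshelve. all: by end_near. Qed.

Let derive1_solution t : 0 < t < T -> u^`()%classic t = slope t.
Proof. by move=> tT; rewrite derive1E; have [_ ->] := is_derive_solution tT. Qed.

Let is_derive_slope t : 0 < t < T -> is_derive t 1 u^`()%classic (- y t).
Proof.
move=> tT; have /andP[t0 t1] := tT.
apply: (@near_eq_is_derive R R^o R^o (fun t : R => (u T - u 0) / T +
  (right_moment T - right_moment t - left_moment t) * T^-1)).
  by near=> s; apply/esym/derive1_solution; near: s; exact: near_itv.
have d1 : is_derive t 1 left_moment (t * y t) by exact: is_derive_seg_int.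
have d2 : is_derive t 1 right_moment ((T - t) * y t) by exact: is_derive_seg_int.
apply: is_derive_eq; rewrite /GRing.scale /=; field; by rewrite gt_eqF.
Unshelve. all: by end_near. Qed.

Lemma kernel_solution_ode t : t \in `]0, T[ -> u^`(2)%classic t + y t = 0.
Proof.
rewrite in_itv /= => tT; change (u^`()^`()%classic t + y t = 0); rewrite derive1E.
by have [_ ->] := is_derive_slope tT; rewrite addNr.
Qed.

Lemma kernel_solution_C2 : C2_on_open T u.
Proof.
move=> t tT; have tT' : 0 < t < T by move: tT; rewrite in_itv.
split; [by have [] := is_derive_solution tT'|by have [] := is_derive_slope tT'|].
have : (fun s => - y s) s @[s --> t] --> - y t by apply: cvgN; exact: y_cont.
have <- : u^`(2)%classic t = - y t by apply/eqP; rewrite -addr_eq0 kernel_solution_ode.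
apply: cvg_trans; apply: near_eq_cvg; near=> s.
apply/eqP; rewrite eq_sym -addr_eq0 kernel_solution_ode // in_itv /=.
by near: s; exact: near_itv.
Unshelve. all: by end_near. Qed.

Hypothesis y_ge0 : forall t, 0 <= t <= T -> 0 <= y t.

Lemma kernel_solution_concave : concave_on T u.
Proof.
move=> x z w x0 xz zw wT; rewrite !uE -!seg_intZ // -seg_intD; first last.
- by move=> s; apply: cvgMl_tmp; exact: cont_y_kernel.
- by move=> s; apply: cvgMl_tmp; exact: cont_y_kernel.
apply: le_seg_int.
- by move=> s; apply: cvgD; apply: cvgMl_tmp; exact: cont_y_kernel.
- by move=> s; apply: cvgMl_tmp; exact: cont_y_kernel.
move=> s sT; rewrite !(mulrCA _ (y s)) -mulrDr ler_wpM2l ?y_ge0 //.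
exact: bvp_kernel_concave.
Qed.

Lemma kernel_solution0 : u 0 = beta * u eta.
Proof.
rewrite !uE -seg_intZ //; apply: eq_seg_int => s sT.
by rewrite bvp_kernel0 // mulrCA.
Qed.

(** The part of the integral over [0, eta] is nonnegative and is dropped; the explicit kernel bound
    holds on the rest. *)
Lemma kernel_solution_lower :
  2 * eta / bvp_det T eta alpha beta * seg_int eta T (fun s => (T - s) * y s) <= u eta.
Proof.
have e0 := ltW eta_gt0; have eT := ltW eta_ltT.
rewrite uE (seg_int_cat (@cont_y_kernel eta) e0 eT) -seg_intZ // -[leLHS]add0r lerD //.
  apply: Rintegral_ge0 => s /=; rewrite in_itv /= => /andP[s0 se].
  have sT : 0 <= s <= T by rewrite s0 (le_trans se).
  by rewrite mulr_ge0 ?y_ge0 // bvp_kernel_ge0 // e0 eT.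
apply: le_seg_int => [|//|s /andP[se sT]].
  by move=> s; apply: cvgMl_tmp; exact: cont_sub_y.
have -> : 2 * eta / bvp_det T eta alpha beta * ((T - s) * y s) =
    y s * (2 * eta * (T - s) / bvp_det T eta alpha beta) by ring.
rewrite ler_wpM2l ?y_ge0 ?(le_trans e0 se) //.
by apply: bvp_kernel_lower; rewrite // se.
Qed.

End KernelSolution.

(** * The cone estimate with constant gamma *)

Section Cone.
Variables (R : realType) (T eta alpha beta : R).
Hypothesis eta_gt0 : 0 < eta.
Hypothesis eta_ltT : eta < T.
Hypothesis alpha_gt0 : 0 < alpha.
Hypothesis beta_ge0 : 0 <= beta.
Hypothesis gap_gt0 : 0 < 2 * T - alpha * (beta + 1) * eta ^+ 2.
Local Notation gamma := (bvp_gamma T eta alpha beta).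

Let T_gt0 : 0 < T. Proof. exact: lt_trans eta_ltT. Qed.
Let ab_gt0 : 0 < alpha * (beta + 1). Proof. by rewrite mulr_gt0 // ltr_wpDl. Qed.

Lemma bvp_gamma_gt0 : 0 < gamma.
Proof.
have b1 : 0 < beta + 1 by rewrite ltr_wpDl.
rewrite /bvp_gamma !lt_min; apply/and3P.
by split; rewrite divr_gt0 // !mulr_gt0 // ?exprn_gt0 // subr_gt0.
Qed.

Lemma bvp_gamma_lt1 : gamma < 1.
Proof.
by rewrite /bvp_gamma gt_min ltr_pdivrMr // mul1r eta_ltT.
Qed.

Variable u : R -> R.
Hypothesis u_cont : continuous u.
Hypothesis u_ge0 : forall t, 0 <= t <= T -> 0 <= u t.
Hypothesis u_concave : concave_on T u.
Hypothesis u0 : u 0 = beta * u eta.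
Hypothesis uT : u T = alpha * seg_int 0 eta u.

(** The trapezoidal bound in the condition at T, with u 0 replaced by beta u eta. *)
Let end_lower : alpha * (beta + 1) * eta / 2 * u eta <= u T.
Proof.
have etaT : 0 <= eta <= T by rewrite !ltW.
have := concave_seg_int etaT u_cont u_concave.
rewrite uT u0 -(ler_pM2l alpha_gt0); apply: le_trans.
by rewrite le_eqVlt; apply/orP; left; apply/eqP; field.
Qed.

(** Each term of the minimum in [bvp_gamma] settles one configuration. For t >= eta, the chord from
    0 gives eta / T at eta, and [end_lower] then gives the second term at T. For t < eta and u T <=
    u eta, the third term is needed. *)
Let gamma_mid t : 0 <= t <= T -> gamma * u t <= u eta /\ gamma * u t <= u T.
Proof.
move=> tT; have /andP[t0 t1] := tT; have ut := u_ge0 tT.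
have uE0 : 0 <= u eta by apply: u_ge0; rewrite !ltW.
have g1 : gamma <= eta / T by rewrite /bvp_gamma ge_min lexx.
have g2 : gamma <= alpha * (beta + 1) * eta ^+ 2 / (2 * T).
  by rewrite /bvp_gamma ge_min ge_min lexx !orbT.
have g3 : gamma <= alpha * (beta + 1) * eta * (T - eta) /
    (2 * T - alpha * (beta + 1) * eta ^+ 2).
  by rewrite /bvp_gamma ge_min ge_min lexx !orbT.
have gle c : gamma <= c -> gamma * u t <= c * u t by move=> h; rewrite ler_wpM2r.
have [et|te] := leP eta t.
  have h : eta / T * u t <= u eta.
    have := u_concave (lexx 0) (ltW eta_gt0) et t1; rewrite !subr0 => h.
    have h1 : eta * u t <= t * u eta.
      by apply: le_trans h; rewrite lerDr mulr_ge0 ?subr_ge0 ?u_ge0 // lexx ltW.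
    have h2 : eta * u t <= T * u eta by apply: le_trans h1 _; rewrite ler_wpM2r.
    by rewrite mulrAC ler_pdivrMr // [leRHS]mulrC.
  split; first exact: le_trans (gle _ g1) h.
  apply: le_trans (gle _ g2) (le_trans _ end_lower).
  have -> : alpha * (beta + 1) * eta ^+ 2 / (2 * T) * u t =
    alpha * (beta + 1) * eta / 2 * (eta / T * u t) by field; rewrite gt_eqF.
  by rewrite ler_pM2l // divr_gt0 // mulr_gt0.
have := u_concave t0 (ltW te) (ltW eta_ltT) (lexx T).
have [wle|elt] := leP (u T) (u eta) => hc.
  suff h : gamma * u t <= u T by split=> //; exact: le_trans wle.
  apply: le_trans (gle _ g3) _; rewrite mulrAC ler_pdivrMr //.
  have dT : 0 < T - eta by rewrite subr_gt0.
  (* Concavity at t, eta, T bounds (T - eta) u t by T u eta - eta u T. Eliminating u eta through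
     [end_lower] leaves the denominator of the third term of gamma times u T. *)
  have h1 : alpha * (beta + 1) * eta * ((T - eta) * u t) <=
     alpha * (beta + 1) * eta * (T * (u eta - u T) + (T - eta) * u T).
    rewrite ler_pM2l ?mulr_gt0 ?ltr_wpDl //.
    have : (T - t) * (u eta - u T) <= T * (u eta - u T).
      by rewrite ler_wpM2r ?subr_ge0 // lerBlDr lerDl.
    move: hc; lra.
  have h2 : 2 * T * (alpha * (beta + 1) * eta / 2 * u eta) <= 2 * T * u T.
    by rewrite ler_pM2l // mulr_gt0.
  move: h1 h2; lra.
(* A concave function that increases from eta to T is at most u eta to the left of eta. *)
have h : u t <= u eta.
  have dT : 0 < T - eta by rewrite subr_gt0.
  rewrite -(ler_pM2l dT).
  have : (eta - t) * u eta <= (eta - t) * u T by rewrite ler_pM2l ?subr_gt0 // ltW.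
  move: hc; lra.
have h1 : gamma * u t <= u t by rewrite ler_piMl // ltW // bvp_gamma_lt1.
by split; [exact: le_trans h1 h|apply: le_trans h1 (le_trans h (ltW elt))].
Qed.

(** On [eta, T] a concave function is at least the smaller of its two end values. *)
Lemma cone_lower t s : 0 <= t <= T -> eta <= s <= T -> gamma * u t <= u s.
Proof.
move=> tT /andP[es sT]; have [h1 h2] := gamma_mid tT.
have dT : 0 < T - eta by rewrite subr_gt0.
rewrite -(ler_pM2l dT); have := u_concave (ltW eta_gt0) es sT (lexx T).
have : (T - s) * (gamma * u t) <= (T - s) * u eta by rewrite ler_wpM2l // subr_ge0.
have : (s - eta) * (gamma * u t) <= (s - eta) * u T by rewrite ler_wpM2l // subr_ge0.
lra.
Qed.

Lemma cone_sup_norm s : eta <= s <= T -> gamma * sup_norm T u <= u s.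
Proof.
move=> sT; rewrite mulrC -ler_pdivlMr ?bvp_gamma_gt0 //.
apply: sup_norm_le => [|t tT]; first exact: ltW.
by rewrite ger0_norm ?u_ge0 // ler_pdivlMr ?bvp_gamma_gt0 // mulrC cone_lower.
Qed.

End Cone.

(** * Continuous extensions and a positive integral *)

Section Extension.
Variable R : realType.

(** Meant for a retraction g onto A, which turns continuity on A into global continuity of an
    extension. *)
Lemma continuous_within_comp (A : set R) (f g : R -> R) :
  {within A, continuous f} -> continuous g -> (forall t, A (g t)) ->
  continuous (f \o g).
Proof.
move=> /subspace_continuousP cf cg gA t.
have := cf (g t) (gA t); apply: cvg_trans => P /= hP.
have h : nbhs (g t) (fun z => A z -> P (f z)) by exact: hP.
have {}h : nbhs t (fun s => A (g s) -> P (f (g s))) by exact: (cg t _ h).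
by apply: (filterS _ h) => s; apply; exact: gA.
Qed.

Lemma bounded_above_segment (f : R -> R) a b : a <= b -> continuous f ->
  exists2 C, 0 <= C & forall x, a <= x <= b -> f x <= C.
Proof.
move=> ab cf; have [c _ hc] := EVT_max ab (continuous_subspaceT cf).
exists (`|f c|) => // x xab; apply: le_trans (ler_norm _).
by apply: hc; rewrite in_itv.
Qed.

(** The point t0 may be b, where the weight vanishes. Hence f is bounded below by f t0 / 2 on an
    interval [p, q] of positive length, whose midpoint is smaller than b. *)
Lemma seg_int_gt0 (f : R -> R) a b t0 : continuous f -> a < b ->
  (forall t, a <= t <= b -> 0 <= f t) -> a <= t0 <= b -> 0 < f t0 ->
  0 < seg_int a b (fun s => (b - s) * f s).
Proof.
move=> cf ab f0 /andP[at0 t0b] ft0.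
have e0 : 0 < f t0 / 2 by lra.
have := cf t0 => /cvgrPdist_lt/(_ _ e0) /nbhs_ballP[d /= d0 hd].
pose p := Num.max a (t0 - d / 2); pose q := Num.min b (t0 + d / 2).
have [pq ap qb] : [/\ p < q, a <= p & q <= b].
  by rewrite /p /q; case: (leP a (t0 - d / 2)) => ?; case: (leP b (t0 + d / 2)) => ?; split; lra.
have near_t0 s : p <= s <= q -> f t0 / 2 <= f s.
  move=> /andP[ps sq]; have : ball t0 d s.
    rewrite /ball /= ltr_norml; move: ps sq; rewrite /p /q ge_max le_min.
    by move=> /andP[? ?] /andP[? ?]; apply/andP; split; lra.
  by move=> /hd /=; rewrite ltr_norml => /andP[? ?]; lra.
have cbf : continuous (fun s : R => (b - s) * f s).
  move=> s; apply: cvgM; last exact: cf.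
  by apply: cvgB; [exact: cvg_cst|exact: cvg_id].
have ge0 x z : a <= x -> z <= b -> 0 <= seg_int x z (fun s => (b - s) * f s).
  move=> ax zb; apply: Rintegral_ge0 => s /=; rewrite in_itv /= => /andP[xs sz].
  have sb := le_trans sz zb; have sa := le_trans ax xs.
  by rewrite mulr_ge0 ?f0 ?subr_ge0 // sa sb.
rewrite (seg_int_cat cbf ap (le_trans (ltW pq) qb)) (seg_int_cat cbf (ltW pq) qb).
rewrite ltr_wpDl ?ge0 // ?(le_trans (ltW pq)) // ltr_pwDl ?ge0 ?(le_trans ap (ltW pq)) //.
apply: (@lt_le_trans _ _ (seg_int p q (fun s => f t0 / 2 * b + - (f t0 / 2) * s))).
  rewrite seg_int_affine ?ltW //.
  have -> : f t0 / 2 * b * (q - p) + - (f t0 / 2) * ((q ^+ 2 - p ^+ 2) / 2) =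
    f t0 / 2 * (q - p) * (b - (p + q) / 2) by field.
  by rewrite !mulr_gt0 // ?subr_gt0 //; lra.
apply: le_seg_int => //.
  by move=> s; apply: cvgD; [exact: cvg_cst|apply: cvgMl_tmp; exact: cvg_id].
move=> s sI; have := near_t0 s sI; have /andP[_ sq] := sI.
have -> : f t0 / 2 * b + - (f t0 / 2) * s = (b - s) * (f t0 / 2) by ring.
by move=> h; rewrite ler_wpM2l // subr_ge0 (le_trans sq qb).
Qed.

Lemma sup_normZ (T c : R) (u : R -> R) : 0 <= T -> 0 < c -> continuous u ->
  sup_norm T (fun t => c * u t) = c * sup_norm T u.
Proof.
move=> T0 c0 cu; apply/eqP; rewrite eq_le; apply/andP; split.
  apply: sup_norm_le => // t tT; rewrite normrM gtr0_norm // ler_pM2l //.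
  exact: sup_norm_ge.
rewrite mulrC -ler_pdivlMr //; apply: sup_norm_le => // t tT.
rewrite ler_pdivlMr // mulrC -[X in X * _](gtr0_norm c0) -normrM.
apply: (@sup_norm_ge _ _ T0 (fun t => c * u t)) => //.
by move=> x; apply: cvgMl_tmp; exact: cu.
Qed.

End Extension.

(** * Growth of the rescaled nonlinearities *)

Section SublinearGrowth.
Variables (R : realType) (f : R -> R).
Hypothesis f_cont : continuous f.
Hypothesis f_ge0 : forall x, 0 <= f x.

Lemma sublinear_at_infty e : f x / x @[x --> +oo] --> 0 -> 0 < e ->
  exists2 C, 0 <= C & forall x, 0 <= x -> f x <= e * x + C.
Proof.
move=> /cvgrPdist_le h e0; have [K [_ hK]] := h e e0.
have K1 : 0 <= Num.max 1 K by rewrite le_max ler01.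
have [C C0 hC] := bounded_above_segment K1 f_cont.
exists C => // x x0; have [xK|Kx] := leP x (Num.max 1 K).
  by apply: le_trans (hC x _) _; rewrite ?x0 // lerDr mulr_ge0 // ltW.
move: Kx; rewrite gt_max => /andP[x1 /hK /=].
have x0' : 0 < x by apply: lt_trans x1.
rewrite sub0r normrN ger0_norm ?divr_ge0 // ler_pdivrMr // => h1.
by apply: le_trans h1 _; rewrite lerDl.
Qed.

Lemma sublinear_at_zero e : f x / x @[x --> 0^'+] --> 0 -> 0 < e ->
  exists2 d, 0 < d & forall x, 0 <= x <= d -> f x <= e * x.
Proof.
(* The limit of the quotient and continuity give f 0 = 0, which extends the estimate to x = 0. *)
move=> h e0; have f00 : f 0 = 0.
  have h1 : f x @[x --> 0^'+] --> f 0 by apply: cvg_at_right_filter; exact: f_cont.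
  have h2 : (f x / x * x : R) @[x --> 0^'+] --> (0 * 0 : R).
    by apply: cvgM => //; apply: cvg_at_right_filter; exact: cvg_id.
  rewrite mulr0 in h2; apply: cvg_unique h1 _ => //.
  apply: cvg_trans h2; apply: near_eq_cvg; near=> x.
  by rewrite mulfVK // gt_eqF //; near: x; exact: nbhs_right_gt.
move/cvgrPdist_le: h => /(_ e e0) /nbhs_ballP[d /= d0 hd].
exists (d / 2); first by rewrite divr_gt0.
move=> x /andP[]; rewrite le_eqVlt => /predU1P[<- _|x0 xd]; first by rewrite f00 mulr0.
have bx : ball 0 d x by rewrite /ball /= sub0r normrN gtr0_norm //; lra.
by have := hd x bx x0; rewrite /= sub0r normrN ger0_norm ?divr_ge0 ?(ltW x0) // ler_pdivrMr.
Unshelve. all: by end_near. Qed.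

(* The substitution v = c u turns -v'' = a f(v) into -u'' = a f(c u) / c.  The
   factor c may depend on the norm n of u. *)
Definition sublinear_rescaling (rho : R) (c : R -> R) := forall e, 0 < e ->
  exists2 B, 0 <= B & forall n m, 0 <= n -> 0 <= m <= Num.max n rho ->
    f (c n * m) / c n <= e * n + B.

Lemma sublinear_rescaling_one rho : 0 < rho -> f x / x @[x --> +oo] --> 0 ->
  sublinear_rescaling rho (fun=> 1).
Proof.
move=> rho0 h e e0; have [C C0 hC] := sublinear_at_infty h e0.
exists (e * rho + C); first by rewrite addr_ge0 // mulr_ge0 // ltW.
move=> n m n0 /andP[m0 mn]; rewrite mul1r divr1; apply: le_trans (hC m m0) _.
rewrite addrA lerD2r -mulrDr ler_pM2l //; apply: le_trans mn _.
by rewrite ge_max lerDl lerDr n0 ltW.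
Qed.

(* Chosen so that c(n) n = rho ^ 2 / n for n >= rho: large norms become small. *)
Definition inversion (rho n : R) := (rho / Num.max n rho) ^+ 2.

(** With N the maximum of n and rho, the argument c m is at most rho^2 / N. If it is at most d, the
    estimate at zero gives f(c m) / c <= e m. If it exceeds d, then N is at most rho^2 / d, so 1 / c
    is at most (rho / d)^2 and f is bounded on [0, rho]. *)
Lemma sublinear_rescaling_inversion rho : 0 < rho -> f x / x @[x --> 0^'+] --> 0 ->
  sublinear_rescaling rho (inversion rho).
Proof.
move=> rho0 h e e0; have [d d0 hd] := sublinear_at_zero h e0.
have [C C0 hC] := bounded_above_segment (ltW rho0) f_cont.
have er0 : 0 <= e * rho by rewrite mulr_ge0 // ltW.
have Cd0 : 0 <= C * (rho / d) ^+ 2 by rewrite mulr_ge0 // exprn_ge0 // divr_ge0 // ltW.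
exists (e * rho + C * (rho / d) ^+ 2); first exact: addr_ge0.
move=> n m n0 /andP[m0 mn]; rewrite /inversion; set N := Num.max n rho in mn *.
have Nrho : rho <= N by rewrite /N le_max lexx orbT.
have N0 : 0 < N by apply: lt_le_trans Nrho.
have Nn : N <= n + rho by rewrite /N ge_max lerDl lerDr n0 ltW.
set c := (rho / N) ^+ 2; have c0 : 0 < c by rewrite exprn_gt0 // divr_gt0.
have cm0 : 0 <= c * m by rewrite mulr_ge0 // ltW.
have cmN : c * m <= rho ^+ 2 / N.
  have -> : rho ^+ 2 / N = c * N by rewrite /c; field; rewrite gt_eqF.
  by rewrite ler_pM2l.
rewrite ler_pdivrMr //; have [cmd|dcm] := leP (c * m) d.
  apply: le_trans (hd _ _) _; first by rewrite cm0.
  rewrite mulrCA mulrC ler_pM2r // addrA -mulrDr.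
  have : e * m <= e * (n + rho) by rewrite ler_pM2l // (le_trans mn).
  lra.
have Nd : N * d <= rho ^+ 2.
  by have := ltW (lt_le_trans dcm cmN); rewrite ler_pdivlMr // mulrC.
have cd : 1 <= (rho / d) ^+ 2 * c.
  have -> : (rho / d) ^+ 2 * c = (rho ^+ 2 / (N * d)) ^+ 2.
    by rewrite /c; field; rewrite !gt_eqF.
  by rewrite exprn_ege1 // ler_pdivlMr ?mulr_gt0 // mul1r.
apply: (@le_trans _ _ C).
  apply: hC; rewrite cm0 /=; apply: le_trans cmN _.
  by rewrite ler_pdivrMr // expr2 ler_pM2l.
rewrite addrA mulrDl -[leLHS]add0r lerD //.
  by rewrite mulr_ge0 ?(ltW c0) // addr_ge0 // mulr_ge0 // ltW.
by rewrite -mulrA ler_peMr.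
Qed.

End SublinearGrowth.

(** * Solutions of the truncated and rescaled equation *)

Section Rescaled.
Variables (R : realType) (T eta alpha beta rho M2 : R) (a f c : R -> R).
Hypothesis eta_gt0 : 0 < eta.
Hypothesis eta_ltT : eta < T.
Hypothesis alpha_gt0 : 0 < alpha.
Hypothesis beta_ge0 : 0 <= beta.
Hypothesis kappa_gt0 : 0 < bvp_kappa T eta alpha.
Hypothesis det_gt0 : 0 < bvp_det T eta alpha beta.
Hypothesis gap_gt0 : 0 < 2 * T - alpha * (beta + 1) * eta ^+ 2.
Hypothesis a_cont : continuous a.
Hypothesis a_ge0 : forall t, 0 <= t <= T -> 0 <= a t.
Hypothesis a_pos : exists2 t0, eta <= t0 <= T & 0 < a t0.
Hypothesis f_cont : continuous f.
Hypothesis f_ge0 : forall x, 0 <= f x.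
Hypothesis rho_gt0 : 0 < rho.
Hypothesis c_cont : continuous c.
Hypothesis c_gt0 : forall n, 0 < c n.
Hypothesis c_one : forall n, n <= rho -> c n = 1.
Hypothesis f_sublinear : sublinear_rescaling f rho c.
Hypothesis M2_ge : bvp_Lambda2 T eta alpha beta a <= M2.
Local Notation gamma := (bvp_gamma T eta alpha beta).
Hypothesis f_ge : forall x, gamma * rho <= x <= rho -> M2 * rho <= f x.

Let T_gt0 : 0 < T. Proof. exact: lt_trans eta_ltT. Qed.
Let gamma_gt0 : 0 < gamma. Proof. exact: bvp_gamma_gt0. Qed.
Let gamma_lt1 : gamma < 1. Proof. exact: bvp_gamma_lt1. Qed.

(* A lower bound for every solution of norm at least rho; inserting it in the
   nonlinearity makes solutions of norm at most rho impossible. *)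
Let low s := gamma * rho * Num.min 1 (s / eta).

Let low_cont : continuous low.
Proof.
move=> s; apply: cvgMl_tmp.
have := @continuous_min R R (fun=> 1) (fun t => t / eta) s; apply.
  exact: cvg_cst.
by apply: cvgMr_tmp; exact: cvg_id.
Qed.

Let low_le s : low s <= rho.
Proof.
apply: (@le_trans _ _ (gamma * rho * 1)).
  by rewrite ler_pM2l ?mulr_gt0 // ge_min lexx.
by rewrite mulr1 ler_piMl // ltW.
Qed.

Let low_right s : eta <= s -> low s = gamma * rho.
Proof. by move=> es; rewrite /low min_l ?mulr1 // ler_pdivlMr // mul1r. Qed.

Let low_left s : s <= eta -> low s = gamma * rho * (s / eta).
Proof. by move=> se; rewrite /low min_r // ler_pdivrMr // mul1r. Qed.

Let rhs s v n := a s * (f (c n * Num.max v (low s)) / c n).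

Let rhs_cont (I : Type) (F : set_system I) (s v n : I -> R) s0 v0 n0 :
  Filter F -> s i @[i --> F] --> s0 -> v i @[i --> F] --> v0 ->
  n i @[i --> F] --> n0 -> rhs (s i) (v i) (n i) @[i --> F] --> rhs s0 v0 n0.
Proof.
move=> FF hs hv hn.
have hc : c (n i) @[i --> F] --> c n0 by apply: continuous_cvg hn; exact: c_cont.
have hl : low (s i) @[i --> F] --> low s0 by apply: continuous_cvg hs; exact: low_cont.
have hm : Num.max (v i) (low (s i)) @[i --> F] --> Num.max v0 (low s0).
  rewrite maxr_absE (_ : (fun i => Num.max (v i) (low (s i))) =
    (fun i => (v i + low (s i) + `|v i - low (s i)|) / 2)); last first.
    by apply/funext => i; rewrite maxr_absE.
  apply: cvgMr_tmp; apply: cvgD; first exact: cvgD.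
  by apply: cvg_norm; exact: cvgB.
have hx : c (n i) * Num.max (v i) (low (s i)) @[i --> F] --> c n0 * Num.max v0 (low s0).
  exact: cvgM.
apply: cvgM; first by apply: continuous_cvg hs; exact: a_cont.
apply: cvgM; last by apply: cvgV => //; rewrite gt_eqF.
by apply: continuous_cvg hx; exact: f_cont.
Qed.

Let rhs_ge0 s v n : 0 <= s <= T -> 0 <= rhs s v n.
Proof. by move=> sT; rewrite mulr_ge0 ?a_ge0 // divr_ge0 // ltW. Qed.

Let fixpoint : exists u : R -> R,
  [/\ continuous u, (forall t, 0 <= t <= T -> 0 <= u t),
      u T = alpha * seg_int 0 eta u,
      continuous (fun s => rhs s (u s) (sup_norm T u)) &
      forall t, u t = seg_int 0 T (fun s => rhs s (u s) (sup_norm T u) *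
        bvp_kernel T eta alpha beta t s)].
Proof.
have T0 := ltW T_gt0; have e0 := ltW eta_gt0; have eT := ltW eta_ltT.
have [L L0 hL] := bvp_kernel_bounded eta_gt0 eta_ltT alpha_gt0 beta_ge0 kappa_gt0 det_gt0.
have [A A0 hA] := bounded_above_segment T0 a_cont.
have TL0 : 0 < T * L by rewrite mulr_gt0.
have A1 : 0 < A + 1 by rewrite ltr_wpDl.
(* This makes (A + 1) e T L equal to 1 / 2, below the threshold 1. A + 1 replaces the bound A of the
   coefficient a to allow A = 0. *)
pose e := (2 * (T * L) * (A + 1))^-1.
have e_gt0 : 0 < e by rewrite invr_gt0 !mulr_gt0.
have [B B0 hB] := f_sublinear e_gt0.
have eps_lt : (A + 1) * e * (T * L) < 1.
  have -> : (A + 1) * e * (T * L) = 1 / 2 by rewrite /e; field; rewrite !gt_eqF.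
  by lra.
apply: (@integral_fixpoint R T eta alpha L ((A + 1) * e) ((A + 1) * B)) => //.
- by move=> t s tT sT; apply: bvp_kernel_ge0.
- by move=> t s tT sT; have [h _] := hL s sT; exact: h.
- by move=> t t' s sT; have [_ h] := hL s sT; exact: h.
- by move=> s; exact: bvp_kernel_continuous.
- by move=> t; exact: bvp_kernel_continuous_r.
- by move=> s sT; exact: bvp_kernelT.
- by rewrite mulr_ge0 // ltW.
- by rewrite mulr_ge0 // ltW.
- by move=> s v n sT _ _; exact: rhs_ge0.
move=> s v n sT v0 vn; have n0 := le_trans v0 vn; have /andP[s0 _] := sT.
rewrite -mulrA -mulrDr /rhs ler_pM ?a_ge0 ?divr_ge0 ?(ltW (c_gt0 n)) //.
  by apply: le_trans (hA s sT) _; rewrite lerDl.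
(* The truncated argument may exceed n, but [low] never exceeds rho; hence the range up to the
   maximum of n and rho in [sublinear_rescaling]. *)
apply: hB => //; rewrite le_max v0 /= ge_max !le_max vn low_le orbT //.
Qed.

Let weight_cont : continuous (fun s : R => (T - s) * a s).
Proof.
move=> s; apply: cvgM; last exact: a_cont.
by apply: cvgB; [exact: cvg_cst|exact: cvg_id].
Qed.

Let weight_gt0 : 0 < seg_int eta T (fun s => (T - s) * a s).
Proof.
have [t0 t0I at0] := a_pos; apply: (seg_int_gt0 a_cont eta_ltT _ t0I at0).
by move=> t /andP[et tT]; rewrite a_ge0 // (le_trans (ltW eta_gt0) et).
Qed.

Lemma rescaled_solution : exists w N,
  [/\ continuous w, rho < N, positive_bvp_solution T eta alpha beta a f w
    & sup_norm T w = c N * N].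
Proof.
have T0 := ltW T_gt0; have e0 := ltW eta_gt0; have eT := ltW eta_ltT.
have eI : 0 <= eta <= T by rewrite e0 eT.
have [u [u_cont u_ge0 uT y_cont uE]] := fixpoint.
set N := sup_norm T u in y_cont uE *.
set y := fun s => rhs s (u s) N in y_cont uE.
have y_ge0 t : 0 <= t <= T -> 0 <= y t by exact: rhs_ge0.
have u_le t : 0 <= t <= T -> u t <= N.
  by move=> tT; apply: le_trans (ler_norm _) (sup_norm_ge _ u_cont tT).
have N0 : 0 <= N by exact: sup_norm_ge0.
have u_conc : concave_on T u.
  exact: (kernel_solution_concave eta_gt0 eta_ltT y_cont uE y_ge0).
have u0 : u 0 = beta * u eta.
  exact: (kernel_solution0 eta_gt0 eta_ltT kappa_gt0 det_gt0 y_cont uE).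
have cone s : eta <= s <= T -> gamma * N <= u s.
  exact: (cone_sup_norm eta_gt0 eta_ltT alpha_gt0 beta_ge0 gap_gt0 u_cont u_ge0).
have rhoN : rho < N.
  rewrite ltNge; apply/negP => Nrho.
  (* If N is small, the cone estimate alone gives only u >= gamma N. The truncation raises the
     argument of f to at least gamma rho, and N <= rho keeps it at most rho. *)
  have lowy s : eta <= s <= T -> M2 * rho * ((T - s) * a s) <= (T - s) * y s.
    move=> /andP[es sT]; have sI : 0 <= s <= T by rewrite sT (le_trans e0).
    rewrite mulrCA ler_wpM2l ?subr_ge0 // mulrC /y /rhs c_one // mul1r divr1.
    rewrite ler_wpM2l ?a_ge0 // f_ge //.
    by rewrite low_right // le_max lexx orbT ge_max (le_trans (u_le s sI)) //= ler_piMl // ltW.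
  have yw : continuous (fun s => (T - s) * y s).
    move=> s; apply: cvgM; last exact: y_cont.
    by apply: cvgB; [exact: cvg_cst|exact: cvg_id].
  have mw : continuous (fun s => M2 * rho * ((T - s) * a s)).
    by move=> s; apply: cvgMl_tmp; exact: weight_cont.
  have h1 := le_seg_int mw yw lowy; rewrite seg_intZ // in h1.
  have h2 : 2 * eta / bvp_det T eta alpha beta * seg_int eta T (fun s => (T - s) * y s) <= u eta.
    exact: (kernel_solution_lower eta_gt0 eta_ltT alpha_gt0 beta_ge0 kappa_gt0 det_gt0 y_cont uE y_ge0).
  have J0 := weight_gt0; set J := seg_int eta T (fun s => (T - s) * a s) in h1 J0.
  (* The inequality Lambda_2 <= M2 with its denominator, positive by [weight_gt0], cleared. *)
  have h3 : bvp_det T eta alpha beta <= M2 * (2 * gamma * eta * J).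
    by rewrite -ler_pdivrMr // !mulr_gt0.
  have h4 : rho <= gamma * u eta.
    apply: (@le_trans _ _ (gamma * (2 * eta / bvp_det T eta alpha beta * (M2 * rho * J)))).
      have -> : gamma * (2 * eta / bvp_det T eta alpha beta * (M2 * rho * J)) =
        rho * (M2 * (2 * gamma * eta * J)) / bvp_det T eta alpha beta by ring.
      by rewrite ler_pdivlMr // ler_pM2l.
    rewrite ler_pM2l //; apply: le_trans h2.
    by rewrite ler_pM2l // divr_gt0 // mulr_gt0.
  have ur : u eta <= rho by exact: le_trans (u_le _ eI) Nrho.
  have : gamma * u eta <= gamma * rho by rewrite ler_pM2l.
  have : gamma * rho < rho by rewrite gtr_pMl.
  lra.
have u_low s : 0 <= s <= T -> low s <= u s.
  move=> /andP[s0 sT]; have gN : gamma * rho <= gamma * N by rewrite ler_pM2l // ltW.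
  have [es|/ltW se] := leP eta s.
    by rewrite low_right // (le_trans gN) // cone // es.
  (* On [0, eta] the chord from 0 to eta gives u s >= (s / eta) u eta, which is the reason for the
     shape of [low]. *)
  rewrite low_left //; have := u_conc 0 s eta (lexx 0) s0 se eT; rewrite !subr0 => h.
  have h1 : s * u eta <= eta * u s.
    by apply: le_trans h; rewrite lerDr mulr_ge0 ?subr_ge0 ?u_ge0 // lexx.
  have h2 : gamma * rho <= u eta by apply: le_trans gN _; apply: cone; rewrite lexx.
  rewrite mulrA ler_pdivrMr // mulrC [leRHS]mulrC; apply: le_trans h1.
  by rewrite ler_wpM2l.
have u_pos s : 0 < s <= T -> 0 < u s.
  move=> /andP[s0 sT]; apply: lt_le_trans (u_low s _); last by rewrite ltW.
  by rewrite !mulr_gt0 // lt_min ltr01 divr_gt0.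
have cN := c_gt0 N.
pose w t := c N * u t.
have wE t : w t = seg_int 0 T (fun s => c N * y s * bvp_kernel T eta alpha beta t s).
  rewrite /w uE -seg_intZ; first by apply: eq_seg_int => s _; rewrite mulrA.
  by move=> s; apply: cvgM; [exact: y_cont|exact: bvp_kernel_continuous_r].
have cy_cont : continuous (fun s => c N * y s).
  by move=> s; apply: cvgMl_tmp; exact: y_cont.
have cyE t : 0 <= t <= T -> c N * y t = a t * f (w t).
  move=> tT; rewrite /y /rhs /w max_l ?u_low //.
  by field; rewrite gt_eqF.
have w_cont : continuous w by move=> s; apply: cvgMl_tmp; exact: u_cont.
exists w, N; split=> //; last exact: sup_normZ.
split.
- split.
  + exact: continuous_subspaceT.
  + exact: (kernel_solution_C2 eta_gt0 eta_ltT cy_cont wE).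
  + move=> t tT; rewrite -cyE; last by move: tT; rewrite in_itv => /andP[/ltW -> /ltW ->].
    exact: (kernel_solution_ode eta_gt0 eta_ltT cy_cont wE).
  + by rewrite /w u0 mulrCA.
  + by rewrite /w uT mulrCA -seg_intZ.
- by move=> t; rewrite in_itv => tT; rewrite mulr_ge0 ?u_ge0 // ltW.
- move=> t; rewrite in_itv /= => /andP[t0 tT].
  by rewrite mulr_gt0 ?u_pos // t0 ltW.
Qed.

End Rescaled.

(** * The two solutions of the original problem *)

Theorem theorem3p2 (R : realType) (T eta alpha beta : R) (f a : R -> R)
  (eta_gt0 : 0 < eta) (eta_ltT : eta < T)
  (alpha_gt0 : 0 < alpha) (alpha_lt : alpha < 2 * T / eta ^+ 2)
  (beta_ge0 : 0 <= beta)
  (beta_lt : beta < (2 * T - alpha * eta ^+ 2) /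
                    (alpha * eta ^+ 2 - 2 * eta + 2 * T))
  (f_cont : {within `[0, +oo[, continuous f})
  (f_ge0 : forall x : R, 0 <= x -> 0 <= f x)
  (a_cont : {within `[0, T], continuous a})
  (a_ge0 : forall t : R, t \in `[0, T] -> 0 <= a t)
  (a_pos : exists2 t0 : R, t0 \in `[eta, T] & 0 < a t0)
  (f_lim0 : f x / x @[x --> 0^'+] --> 0)
  (f_limoo : f x / x @[x --> +oo] --> 0)
  (rho2 M2 : R) (rho2_gt0 : 0 < rho2)
  (M2_ge : bvp_Lambda2 T eta alpha beta a <= M2)
  (f_ge : forall x : R,
     x \in `[bvp_gamma T eta alpha beta * rho2, rho2] -> M2 * rho2 <= f x) :
  exists u1 u2 : R -> R,
    [/\ positive_bvp_solution T eta alpha beta a f u1,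
        positive_bvp_solution T eta alpha beta a f u2,
        0 < sup_norm T u1,
        sup_norm T u1 < rho2
      & rho2 < sup_norm T u2].
Proof.
have T_gt0 : 0 < T by exact: lt_trans eta_ltT.
have kappa_gt0 : 0 < bvp_kappa T eta alpha.
  by rewrite /bvp_kappa subr_gt0 -ltr_pdivlMr // exprn_gt0.
have w0 : 0 < alpha * eta ^+ 2 - 2 * eta + 2 * T.
  have : 0 < alpha * eta ^+ 2 by rewrite mulr_gt0 // exprn_gt0.
  lra.
have det_gt0 : 0 < bvp_det T eta alpha beta.
  by rewrite /bvp_det subr_gt0 -ltr_pdivlMr.
have gap_gt0 : 0 < 2 * T - alpha * (beta + 1) * eta ^+ 2.
  (* The gap equals det + 2 beta (T - eta). *)
  have : 0 <= beta * (2 * T - 2 * eta) by rewrite mulr_ge0 //; lra.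
  move: det_gt0; rewrite /bvp_det; lra.
(* Retractions onto [0, T] and onto the nonnegative half-line extend a and f to continuous functions
   on the whole line. *)
pose clamp (t : R) := Num.max 0 (Num.min t T).
have clampE t : 0 <= t <= T -> clamp t = t.
  by move=> /andP[t0 tT]; rewrite /clamp min_l // max_r.
have clamp_itv t : 0 <= clamp t <= T.
  by rewrite /clamp le_max lexx /= ge_max (ltW T_gt0) ge_min lexx orbT.
have max_cont : continuous (Num.max 0 : R -> R).
  move=> x; have := @continuous_max R R (fun=> 0) id x; apply; first exact: cvg_cst.
  exact: cvg_id.
have min_cont : continuous (fun t : R => Num.min t T).
  move=> x; have := @continuous_min R R id (fun=> T) x; apply; first exact: cvg_id.
  exact: cvg_cst.
have clamp_cont : continuous clamp.
  move=> t; have h : Num.min s T @[s --> t] --> Num.min t T by exact: min_cont.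
  by apply: continuous_cvg h; exact: max_cont.
pose a' := a \o clamp; pose f' := f \o Num.max 0.
have a'_cont : continuous a'.
  by apply: continuous_within_comp a_cont clamp_cont _ => t; rewrite /= in_itv clamp_itv.
have f'_cont : continuous f'.
  apply: continuous_within_comp f_cont max_cont _ => t.
  by rewrite /= in_itv /= le_max lexx.
have a'E t : 0 <= t <= T -> a' t = a t by move=> tT; rewrite /a' /= clampE.
have f'E x : 0 <= x -> f' x = f x by move=> x0; rewrite /f' /= max_r.
have a'_ge0 t : 0 <= t <= T -> 0 <= a' t.
  by move=> tT; rewrite a'E // a_ge0 // in_itv.
have f'_ge0 x : 0 <= f' x by rewrite /f' /= f_ge0 // le_max lexx.
have a'_pos : exists2 t0, eta <= t0 <= T & 0 < a' t0.
  have [t0] := a_pos; rewrite in_itv /= => /andP[et tT] at0; exists t0; rewrite ?et //.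
  by rewrite a'E // tT (le_trans (ltW eta_gt0)).
have f'_lim0 : f' x / x @[x --> 0^'+] --> 0.
  apply: cvg_trans f_lim0; apply: near_eq_cvg; near=> x.
  by rewrite f'E //; apply: ltW; near: x; exact: nbhs_right_gt.
have f'_limoo : f' x / x @[x --> +oo] --> 0.
  apply: cvg_trans f_limoo; apply: near_eq_cvg; near=> x.
  by rewrite f'E //; near: x; exact: nbhs_pinfty_ge.
have M2_ge' : bvp_Lambda2 T eta alpha beta a' <= M2.
  rewrite (_ : bvp_Lambda2 T eta alpha beta a' = bvp_Lambda2 T eta alpha beta a) //.
  congr (_ / (_ * _)); apply: eq_seg_int => s /andP[es sT].
  by rewrite a'E // sT (le_trans (ltW eta_gt0)).
have gamma_gt0 := bvp_gamma_gt0 eta_gt0 eta_ltT alpha_gt0 beta_ge0 gap_gt0.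
have f'_ge x : bvp_gamma T eta alpha beta * rho2 <= x <= rho2 -> M2 * rho2 <= f' x.
  move=> xI; have /andP[x1 _] := xI; rewrite f'E ?f_ge ?in_itv //.
  by apply: le_trans x1; rewrite mulr_ge0 // ltW.
(* The equation evaluates a only inside (0, T) and f only at values of u, which are nonnegative
   there, so the extensions do not change it. *)
have restrict u : positive_bvp_solution T eta alpha beta a' f' u ->
    positive_bvp_solution T eta alpha beta a f u.
  move=> [[u_cont u_C2 u_ode u_0 u_T] u_ge0 u_gt0]; split=> //; split=> // t tT.
  have tI : 0 <= t <= T by move: tT; rewrite in_itv => /andP[/ltW -> /ltW ->].
  by rewrite -(u_ode t tT) a'E // f'E // u_ge0 // in_itv.
have solution := @rescaled_solution R T eta alpha beta rho2 M2 a' f' _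
  eta_gt0 eta_ltT alpha_gt0 beta_ge0 kappa_gt0 det_gt0 gap_gt0 a'_cont a'_ge0 a'_pos
  f'_cont f'_ge0 rho2_gt0.
have inv_cont : continuous (inversion rho2).
  have h : continuous (fun n => rho2 / Num.max n rho2).
    move=> n; apply: cvgMl_tmp; apply: cvgV.
      by rewrite gt_eqF // lt_max rho2_gt0 orbT.
    have := @continuous_max R R id (fun=> rho2) n; apply; first exact: cvg_id.
    exact: cvg_cst.
  by move=> n; apply: cvgM; exact: h.
have inv_gt0 n : 0 < inversion rho2 n.
  by rewrite exprn_gt0 // divr_gt0 // lt_max rho2_gt0 orbT.
have inv_one n : n <= rho2 -> inversion rho2 n = 1.
  by move=> h; rewrite /inversion max_r // divff ?gt_eqF // expr1n.
have [u1 [N1 [_ N1_gt u1_sol u1_norm]]] := solution _ inv_cont inv_gt0 inv_one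
  (sublinear_rescaling_inversion f'_cont f'_ge0 rho2_gt0 f'_lim0) M2_ge' f'_ge.
have one_cont : continuous (fun _ : R => 1 : R) by exact: cst_continuous.
have [u2 [N2 [_ N2_gt u2_sol u2_norm]]] := solution _ one_cont (fun=> ltr01) (fun _ _ => erefl)
  (sublinear_rescaling_one f'_cont f'_ge0 rho2_gt0 f'_limoo) M2_ge' f'_ge.
have N1_gt0 : 0 < N1 by exact: lt_trans N1_gt.
exists u1, u2; split; [exact: restrict|exact: restrict|..].
- by rewrite u1_norm mulr_gt0.
- rewrite u1_norm /inversion max_l ?(ltW N1_gt) //.
  have -> : (rho2 / N1) ^+ 2 * N1 = rho2 * (rho2 / N1) by field; rewrite gt_eqF.
  by rewrite gtr_pMr // ltr_pdivrMr // mul1r.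
- by rewrite u2_norm mul1r.
Unshelve. all: by end_near. Qed.
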